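(* Suppose $b\equiv0$ and $\alpha_1=\cdots=\alpha_n=\alpha>0$, let $x_1,\dots,x_n\in\mathbb R$ and let $X_1^*,\dots,X_n^*$ be the unique Nash equilibrium for mean-variance optimization on $[0,T]$. Put $$\widehat\theta=\frac{\sqrt{\gamma^2+4\alpha\sigma^2\lambda}}{2\lambda},\qquad \widehat\rho=\frac{\sqrt{(n-1)^2\gamma^2+4(n+1)\alpha\sigma^2\lambda}}{2(n+1)\lambda},$$ $$\theta_\pm=\frac{\gamma}{2\lambda}\pm\widehat\theta,\qquad \rho_\pm=-\frac{(n-1)\gamma}{2(n+1)\lambda}\pm\widehat\rho,$$ and $\overline x_n=\frac1n\sum_{j=1}^nx_j$. Then $$X_i^*(t)=c_i(\theta_+)e^{\theta_+t}+c_i(\theta_-)e^{\theta_-t}+c(\rho_+)e^{\rho_+t}+c(\rho_-)e^{\rho_-t},$$ where $$c_i(\theta_+)=\frac{\overline x_n-x_i}{e^{2\widehat\theta T}-1},\quad c_i(\theta_-)=\frac{-(\overline x_n-x_i)}{1-e^{-2\widehat\theta T}},\quad c(\rho_+)=\frac{-\overline x_n}{e^{2\widehat\rho T}-1},\quad c(\rho_-)=\frac{\overline x_n}{1-e^{-2\widehat\rho T}}.$$ Moreover $\Sigma(t)=\sum_{i=1}^nX_i^*(t)$ is given by $$\Sigma(t)=\frac{n\overline x_n}{2\sinh(\widehat\rho T)}\Big(e^{\widehat\rho T}e^{\rho_-t}-e^{-\widehat\rho T}e^{\rho_+t}\Big),$$ and it is the solution of $\alpha\sigma^2\Sigma(t)-(n-1)\gamma\dot\Sigma(t)-(n+1)\lambda\ddot\Sigma(t)=0$,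 $\Sigma(0)=\sum_ix_i$, $\Sigma(T)=0$.
   Context: Fix $T>0$, $n\in\mathbb N$, a filtered probability space carrying a standard Brownian motion $W$, constants $S_0\in\mathbb R$, $\sigma\ge0$, $\gamma\ge0$, $\lambda>0$; the unaffected price is $S^0(t)=S_0+\sigma W(t)$ (zero drift). $\mathscr X_{\det}(x,T)$ is the set of deterministic absolutely continuous, bounded functions $X$ on $[0,T]$ with $\int_0^T\dot X(t)^2dt<\infty$, $X(0)=x$, $X(T)=0$. When $n$ agents use $X_1,\dots,X_n$, the price is $S^{X_1,\dots,X_n}(t)=S^0(t)+\gamma\sum_{j=1}^n(X_j(t)-X_j(0))+\lambda\sum_{j=1}^n\dot X_j(t)$ and agent $i$'s revenues are $\mathscr R(X_i|\mathbf X_{-i})=-\int_0^T\dot X_i(t)S^{X_1,\dots,X_n}(t)dt$, $\mathbf X_{-i}=\{X_j:j\neq i\}$. A Nash equilibrium for mean-variance optimization (initial positions $x_i$, risk aversions $\alpha_i\ge0$) is a collection of $X_i^*\in\mathscr X_{\det}(x_i,T)$ such that each $X_i^*$ maximizes $X\mapsto\mathbb E[\mathscr R(X|\mathbf X^*_{-i})]-\frac{\alpha_i}{2}\mathrm{var}(\mathscr R(X|\mathbf X^*_{-i}))$ over $\mathscr X_{\det}(x_i,T)$ (agent $i$ uses $X$, agents $j\neq i$ use $X_j^*$); it exists and is unique.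
   Formalization: The formal statement assumes θ̂ > 0 and ρ̂ > 0; this is automatic for σ > 0 and excludes only σ = 0 with n = 1 or γ = 0, where ρ̂ = 0 and the denominators e^{2ρ̂T}−1 and sinh(ρ̂T) in the displayed formulas vanish. *)

(* Defs.v *)
From HB Require Import structures.
From mathcomp Require Import all_boot all_order all_algebra.
From mathcomp Require Import all_classical all_reals all_analysis.
Set Implicit Arguments. Unset Strict Implicit. Unset Printing Implicit Defensive.
Import Order.TTheory GRing.Theory Num.Theory.
Import numFieldNormedType.Exports.
Local Open Scope classical_set_scope.
Local Open Scope ring_scope.

Section defs.
Context {R : realType} {d : measure_display} {Omega : measurableType d}.
Notation mu := (@lebesgue_measure R).

Definition standard_BM (P : probability Omega R) (W : R -> Omega -> R) : Prop :=
  [/\ (forall w, W 0 w = 0),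
      (forall w, {within `[0, +oo[, continuous (fun t => W t w)}),
      (forall t, measurable_fun setT (W t)),
      (forall s t, 0 <= s -> s < t -> forall A : set R, measurable A ->
          P ((fun w => W t w - W s w) @^-1` A) = normal_prob 0 (Num.sqrt (t - s)) A)
    & (forall (k : nat) (tt : nat -> R), 0 <= tt 0%N ->
          (forall j, (j < k)%N -> tt j <= tt j.+1) ->
          forall A : nat -> set R, (forall j, measurable (A j)) ->
          fine (P (\bigcap_(j in [set j | (j < k)%N])
                     ((fun w => W (tt j.+1) w - W (tt j) w) @^-1` A j)))
          = \prod_(j < k) fine (P ((fun w => W (tt j.+1) w - W (tt j) w) @^-1` A j)))].

(** Admissible deterministic strategies in X_det(x, T), represented through
    their rate v = dX/dt : X(t) = x + int_0^t v, with int_0^T v^2 < oo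
    and X(T) = 0. *)
Definition admissible (T x : R) (v : R -> R) : Prop :=
  [/\ mu.-integrable `[0, T] (EFin \o v),
      mu.-integrable `[0, T] (EFin \o (fun t => v t ^+ 2))
    & x + \int[mu]_(s in `[0, T]) v s = 0].

Definition pos (x : R) (v : R -> R) (t : R) : R := x + \int[mu]_(s in `[0, t]) v s.

Definition price (n : nat) (W : R -> Omega -> R) (S0 sigma gamma lambda : R)
  (xs : 'I_n -> R) (vs : 'I_n -> R -> R) (t : R) (w : Omega) : R :=
  S0 + sigma * W t w + gamma * (\sum_(j < n) (pos (xs j) (vs j) t - xs j))
     + lambda * (\sum_(j < n) vs j t).

Definition upd (n : nat) (vs : 'I_n -> R -> R) (i : 'I_n) (v : R -> R) : 'I_n -> R -> R :=
  fun j => if j == i then v else vs j.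

Definition revenue (n : nat) (W : R -> Omega -> R) (T S0 sigma gamma lambda : R)
  (xs : 'I_n -> R) (vs : 'I_n -> R -> R) (i : 'I_n) : Omega -> R :=
  fun w => - \int[mu]_(t in `[0, T]) (vs i t * price W S0 sigma gamma lambda xs vs t w).

Definition mean_var (P : probability Omega R) (alpha : R) (X : Omega -> R) : \bar R :=
  ('E_P[X] - (alpha / 2)%:E * 'V_P[X])%E.

Definition nash_mv (P : probability Omega R) (W : R -> Omega -> R)
  (T S0 sigma gamma lambda : R) (n : nat) (alphas xs : 'I_n -> R)
  (vs : 'I_n -> R -> R) : Prop :=
  forall i : 'I_n, admissible T (xs i) (vs i) /\
    forall v, admissible T (xs i) v ->
      (mean_var P (alphas i) (revenue W T S0 sigma gamma lambda xs (upd vs i v) i)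
       <= mean_var P (alphas i) (revenue W T S0 sigma gamma lambda xs vs i))%E.

End defs.

(* Main.v *)
(** Agent i's revenue is a constant minus [sigma * Z], where [Z] integrates the trading
    rate [v] against the Brownian path.  Since [E[W s * W t] = min s t], Fubini gives [Z]
    mean zero and variance equal to the integral of [X^2], [X] being the position, so the
    mean-variance functional is a deterministic quadratic functional of [v].  Perturbing
    an optimal [v] along mean-zero directions shows that
<<
      lambda (v_i + sum_j v_j) + gamma sum_(j != i) X_j - alpha sigma^2 \int_0^t X_i
>>
    is almost everywhere constant in t.  Summing over i gives a second-order linear
    equation for the total position with characteristic roots rho_+ and rho_-, and
    subtracting the average gives one for X_i minus the mean position with roots theta_+
    and theta_-; the boundary values fix the coefficients. *)

Require Import Defs.
From HB Require Import structures.
From mathcomp Require Import all_boot all_order all_algebra.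
From mathcomp Require Import ring lra.
From mathcomp Require Import all_classical all_reals all_analysis.
From mathcomp Require Import measurable_realfun.
Set Implicit Arguments. Unset Strict Implicit. Unset Printing Implicit Defensive.
Import Order.TTheory GRing.Theory Num.Theory.
Import numFieldNormedType.Exports.
Local Open Scope classical_set_scope.
Local Open Scope ring_scope.

(** * Fubini and primitives of integrable functions *)

(** Trading rates are only square-integrable, so a position has no derivative that is known at every
    time. Every integration by parts below is therefore Fubini on a triangle, valid for primitives
    of integrable functions. It serves three ends: it evaluates the covariance kernel [min s t], it
    shows that an agent's own permanent impact costs the same for all admissible strategies, and it
    moves the risk term from the perturbed position onto the perturbed rate, which is the origin of
    the integral of [X_i] in the first-order condition. The perturbation direction is the mean-zero
    part of the gradient itself, so no class of test functions appears: the first variation in that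
    direction is the squared norm that has to vanish. Smoothness is recovered only afterwards. The
    resulting identity equates the relevant combination of rates almost everywhere with a continuous
    function, and integrating it makes the corresponding position differentiable inside the
    interval, then twice differentiable. *)

Section fubini_real.
Context d1 d2 (T1 : measurableType d1) (T2 : measurableType d2) (R : realType).
Variables (m1 : {sigma_finite_measure set T1 -> \bar R})
          (m2 : {sigma_finite_measure set T2 -> \bar R}).

(** The inner integrals are known to be finite only almost everywhere; where they are not, [fine]
    returns a default value, and this happens on a null set only. *)
Lemma Rintegral_fubini (f : T1 * T2 -> R) :
  (m1 \x m2)%E.-integrable setT (EFin \o f) ->
  \int[m1]_x \int[m2]_y f (x, y) = \int[m2]_y \int[m1]_x f (x, y).
Proof.
move=> intf; rewrite /Rintegral; congr fine.
transitivity (\int[m1]_x \int[m2]_y (f (x, y))%:E)%E.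
  apply: ae_eq_integral => //.
  - apply/measurable_EFinP/measurableT_comp => //.
    exact: (measurable_fubini_F intf).
  - exact: (measurable_fubini_F intf).
  - have := ae_integrable1 intf.
    apply: filterS => x intx _ /=.
    by rewrite fineK//; exact: integrable_fin_num.
rewrite (Fubini intf); apply: ae_eq_integral => //.
- exact: (measurable_fubini_G intf).
- apply/measurable_EFinP/measurableT_comp => //.
  exact: (measurable_fubini_G intf).
- have := ae_integrable2 intf.
  apply: filterS => x intx _ /=.
  by rewrite fineK//; exact: integrable_fin_num.
Qed.
End fubini_real.

Section real_integrable.
Context d (T : measurableType d) (R : realType) (m : {measure set T -> \bar R}).
Variables (D : set T) (f g : T -> R).
Hypothesis mD : measurable D.
Hypothesis intf : m.-integrable D (EFin \o f).

Lemma integrable_realD : m.-integrable D (EFin \o g) ->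
  m.-integrable D (EFin \o (fun x => f x + g x)).
Proof. by move=> intg; have := integrableD mD intf intg. Qed.

Lemma integrable_realB : m.-integrable D (EFin \o g) ->
  m.-integrable D (EFin \o (fun x => f x - g x)).
Proof. by move=> intg; have := integrableB mD intf intg. Qed.

Lemma integrable_realZl c : m.-integrable D (EFin \o (fun x => c * f x)).
Proof. by have := integrableZl mD c intf. Qed.

End real_integrable.

Lemma integrable_tensor d1 d2 (T1 : measurableType d1) (T2 : measurableType d2)
    (R : realType) (m1 : {sigma_finite_measure set T1 -> \bar R})
    (m2 : {sigma_finite_measure set T2 -> \bar R}) (f : T1 -> R) (g : T2 -> R) :
  m1.-integrable setT (EFin \o f) -> m2.-integrable setT (EFin \o g) ->
  (m1 \x m2)%E.-integrable setT (EFin \o (fun z => f z.1 * g z.2)).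
Proof.
move=> intf intg.
have mf : measurable_fun setT f by apply/measurable_EFinP; exact: measurable_int intf.
have mg : measurable_fun setT g by apply/measurable_EFinP; exact: measurable_int intg.
have mfg : measurable_fun setT (fun z : T1 * T2 => f z.1 * g z.2).
  by apply: measurable_funM; exact: measurableT_comp.
apply/integrable12ltyP; first exact/measurable_EFinP.
set C := (\int[m2]_y `|(g y)%:E|)%E.
have C_fin : C \is a fin_num.
  by apply: integrable_fin_num => //; exact: integrable_abse.
rewrite (_ : (\int[m1]_x _)%E = (\int[m1]_x (`|(f x)%:E| * C))%E); last first.
  apply: eq_integral => x _ /=.
  under eq_integral do rewrite normrM EFinM.
  rewrite ge0_integralZl//=.
  by apply/measurable_EFinP; exact: measurableT_comp.
rewrite -(fineK C_fin) integralZr//; last exact: integrable_abse.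
rewrite -ge0_fin_numE; last by rewrite mule_ge0 ?integral_ge0// fineK// integral_ge0.
by rewrite fin_numM//; apply: integrable_fin_num => //; exact: integrable_abse.
Qed.

Lemma integrable_patch d (T : measurableType d) (R : realType)
    (m : {measure set T -> \bar R}) (D : set T) (f : T -> R) :
  measurable D -> m.-integrable D (EFin \o f) ->
  m.-integrable setT (EFin \o f \_ D).
Proof. by move=> mD; rewrite -restrict_EFin => /(integrable_mkcond _ mD). Qed.

Section segment_integrals.
Context {R : realType}.
Notation mu := (@lebesgue_measure R).
Implicit Types (f g : R -> R) (T t : R).

Lemma integrable_segmentW f T t : t <= T ->
  mu.-integrable `[0, T] (EFin \o f) -> mu.-integrable `[0, t] (EFin \o f).
Proof.
by move=> tT; apply: integrableS => //; apply: subset_itvl; rewrite bnd_simp.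
Qed.

Lemma integrable_mul_continuous f g T :
  mu.-integrable `[0, T] (EFin \o f) -> {within `[0, T], continuous g} ->
  mu.-integrable `[0, T] (EFin \o (fun t => f t * g t)).
Proof.
move=> intf cg; apply: (integrableMl _ intf) => //.
  exact: subspace_continuous_measurable_fun.
have := continuous_compact cg (@segment_compact _ 0 T).
move=> /compact_bounded [M [Mr HM]]; exists M; split => // x Mx y yD.
by apply: (HM _ Mx); exists y.
Qed.

(** Extends both functions by zero and turns the moving upper bound into an indicator, so that
    Fubini on the whole plane applies. *)
Lemma Rintegral_mul_segment f g T : 
  mu.-integrable `[0, T] (EFin \o f) -> mu.-integrable `[0, T] (EFin \o g) ->
  \int[mu]_(t in `[0, T]) (f t * \int[mu]_(s in `[0, t]) g s) =
  \int[mu]_t \int[mu]_s ((f \_ `[0, T]) t * (g \_ `[0, T]) s * (s <= t)%R%:R).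
Proof.
move=> intf intg; rewrite [LHS]Rintegral_mkcond; apply: eq_Rintegral => t _.
under [RHS]eq_Rintegral do rewrite -mulrA.
rewrite [LHS]patchE [in RHS](patchE f); case: ifPn => tD; last first.
  by under eq_Rintegral do rewrite mul0r; rewrite Rintegral_cst// mul0r.
have {}tD : 0 <= t <= T by move: tD; rewrite inE/= in_itv.
case/andP: tD => t0 tT.
have E : (fun s => (g \_ `[0, T]) s * (s <= t)%R%:R) =
         g \_ `[0, t].
  apply/funext => s; rewrite /patch !mem_setE !in_itv/=.
  case: (leP 0 s) => s0 //=; last by rewrite mul0r.
  case: (leP s t) => st/=; last by rewrite mulr0.
  by rewrite (le_trans st tT) mulr1.
rewrite RintegralZl//; last first.
  by rewrite E; apply: integrable_patch => //; exact: integrable_segmentW tT intg.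
by rewrite E -Rintegral_mkcond.
Qed.

(** Integration by parts for primitives of functions that are merely integrable. The two terms are
    the integrals of [f s * g t] over the triangles t <= s and s <= t, which together fill the
    square. *)
Lemma Rintegral_parts_primitive f g T : 0 <= T ->
  mu.-integrable `[0, T] (EFin \o f) -> mu.-integrable `[0, T] (EFin \o g) ->
  \int[mu]_(t in `[0, T]) (f t * \int[mu]_(s in `[0, t]) g s) +
  \int[mu]_(t in `[0, T]) (g t * \int[mu]_(s in `[0, t]) f s) =
  (\int[mu]_(t in `[0, T]) f t) * (\int[mu]_(t in `[0, T]) g t).
Proof.
move=> T0 intf intg.
have int_patch (h : R -> R) : mu.-integrable `[0, T] (EFin \o h) ->
    mu.-integrable setT (EFin \o h \_ `[0, T]) by exact: integrable_patch.
(* The triangle of the second term; it is integrable because the tensor product of the two functions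
   dominates it. *)
pose H (z : R * R) := (f \_ `[0, T]) z.2 * (g \_ `[0, T]) z.1 * (z.2 <= z.1)%R%:R.
have intH : (mu \x mu)%E.-integrable setT (EFin \o H).
  have /= int2 := integrable_tensor (int_patch _ intg) (int_patch _ intf).
  apply: le_integrable int2 => //.
    apply/measurable_EFinP; rewrite /H.
    apply: measurable_funM.
      apply: measurable_funM; apply: measurableT_comp => //;
      by apply/measurable_EFinP; apply: (measurable_int mu); exact: int_patch.
    have -> : (fun x : R * R => (x.2 <= x.1)%R%:R : R) =
              (fun x : R * R => if (x.2 <= x.1)%R then 1 else 0).
      by apply/funext => x; case: (_ <= _).
    by apply: measurable_fun_ifT => //; exact: measurable_fun_ler.
  move=> z _; rewrite lee_fin /H normrM (mulrC (patch _ _ _ _)) ler_piMr//.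
  by case: (z.2 <= z.1)%R; rewrite /= ?normr1 ?normr0 ?ler01.
rewrite [X in _ + X]Rintegral_mul_segment//.
rewrite (_ : (\int[mu]_t \int[mu]_s ((g \_ `[0, T]) t * (f \_ `[0, T]) s * (s <= t)%R%:R))
  = \int[mu]_s \int[mu]_t H (t, s)); last first.
  rewrite -(Rintegral_fubini intH); apply: eq_Rintegral => t _; apply: eq_Rintegral => s _.
  by rewrite /H/= [X in X * _]mulrC.
rewrite [LHS](_ : _ = \int[mu]_(s in `[0, T]) (f s * \int[mu]_(t in `[0, s]) g t)
  + \int[mu]_(s in `[0, T]) (f s * (\int[mu]_(t in `[0, T]) g t - \int[mu]_(t in `[0, s]) g t)));
  last first.
  congr (_ + _); rewrite [RHS]Rintegral_mkcond; apply: eq_Rintegral => s _.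
  rewrite [RHS]patchE /H/= (patchE f); case: ifPn => sD; last first.
    by under eq_Rintegral do rewrite !mul0r; rewrite Rintegral_cst// mul0r.
  have {}sD : 0 <= s <= T by move: sD; rewrite inE/= in_itv.
  case/andP: sD => s0 sT.
  have E : (fun t => (g \_ `[0, T]) t * (s <= t)%R%:R) =
           g \_ `[s, T].
    apply/funext => t; rewrite /patch !mem_setE !in_itv/=.
    case: (leP s t) => st /=; last by rewrite mulr0.
    by rewrite (le_trans s0 st)/=; case: (t <= T); rewrite mulr1.
  have intgs : mu.-integrable `[s, T] (EFin \o g).
    by apply: integrableS intg => //; apply: subset_itvr; rewrite bnd_simp.
  under eq_Rintegral do rewrite -mulrA.
  rewrite RintegralZl//; last first.
    by rewrite E; exact: integrable_patch.
  rewrite E -Rintegral_mkcond Rintegral_itvB// Rintegral_itv_obnd_cbnd//.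
  by apply: integrableS intgs => //; exact: subset_itv_oc_cc.
have cg := parameterized_integral_continuous T0 intg.
have bg c : mu.-integrable `[0, T]
    (EFin \o (fun s => f s * (c - \int[mu]_(t in `[0, s]) g t))).
  apply: integrable_mul_continuous => //.
  apply/subspace_continuousP => x xD; apply: cvgB; first exact: cvg_cst.
  by move/subspace_continuousP: cg; exact.
rewrite -RintegralD//; last exact: integrable_mul_continuous.
under eq_Rintegral do rewrite -mulrDr addrC subrK.
by rewrite RintegralZr.
Qed.

Lemma integrable_segmentD T f g : mu.-integrable `[0, T] (EFin \o f) ->
  mu.-integrable `[0, T] (EFin \o g) ->
  mu.-integrable `[0, T] (EFin \o (fun t => f t + g t)).
Proof. exact: integrable_realD. Qed.

Lemma integrable_segmentZ T (c : R) f : mu.-integrable `[0, T] (EFin \o f) ->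
  mu.-integrable `[0, T] (EFin \o (fun t => c * f t)).
Proof. by move=> intf; exact: integrable_realZl. Qed.

Lemma integrable_cst_segment T (c : R) : mu.-integrable `[0, T] (EFin \o cst c).
Proof.
apply: continuous_compact_integrable; first exact: segment_compact.
by apply: continuous_subspaceT => x; exact: cvg_cst.
Qed.

Lemma Rintegral_cst_segment T (c : R) : 0 <= T ->
  \int[mu]_(t in `[0, T]) c = c * T.
Proof.
move=> T0; rewrite Rintegral_cst//= lebesgue_measure_itv/= lte_fin.
case: ltP => [_|TN]; first by rewrite sube0.
by rewrite (_ : T = 0)//; apply/le_anti; rewrite TN.
Qed.

(** As a function of [t], [Num.min s t] is the primitive of the indicator of [[0, s]], so this is
    integration by parts against that indicator. *)
Lemma Rintegral_mul_min f T s : 0 <= s <= T ->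
  mu.-integrable `[0, T] (EFin \o f) ->
  \int[mu]_(t in `[0, T]) (f t * Num.min s t) =
  (\int[mu]_(t in `[0, T]) f t) * s -
  \int[mu]_(t in `[0, s]) \int[mu]_(r in `[0, t]) f r.
Proof.
case/andP=> s0 sT intf; have T0 := le_trans s0 sT.
pose g : R -> R := (fun=> 1 : R) \_ `[0, s].
have g_prim t : 0 <= t -> \int[mu]_(r in `[0, t]) g r = Num.min s t.
  move=> t0; rewrite /g -Rintegral_mkcondr.
  rewrite (_ : _ `&` _ = `[0, Num.min s t]%classic); last first.
    apply/seteqP; split => r /=; rewrite !in_itv/= le_min.
      by case=> /andP[-> ->] /andP[_ ->].
    by case/andP=> -> /andP[-> ->].
  by rewrite Rintegral_cst_segment ?mul1r// le_min s0.
have intg : mu.-integrable `[0, T] (EFin \o g).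
  rewrite /g -restrict_EFin; apply/integrable_restrict => //.
  by apply: integrableS (integrable_cst_segment T 1) => //; exact: measurableI.
have := Rintegral_parts_primitive T0 intf intg.
rewrite [\int[mu]_(t in `[0, T]) g t]g_prim// (min_idPl sT) => <-.
rewrite (_ : \int[mu]_(t in `[0, T]) (g t * _) =
  \int[mu]_(t in `[0, s]) \int[mu]_(r in `[0, t]) f r); last first.
  rewrite [LHS]Rintegral_mkcond [RHS]Rintegral_mkcond; apply: eq_Rintegral => t _.
  rewrite /g !patchE !mem_setE !in_itv/=; case: (leP 0 t) => //= t0.
  case: (leP t s) => ts; last by rewrite mul0r if_same.
  by rewrite (le_trans ts sT) mul1r.
rewrite addrK; apply: eq_Rintegral => t; rewrite mem_setE in_itv/= => /andP[t0 _].
by rewrite g_prim.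
Qed.

(* The left-hand side is the variance of the integral of [f] against a Brownian path, the
   right-hand side the quadratic risk of the position that trades at rate [f]. *)
Lemma Rintegral_min_kernel f T : 0 <= T -> mu.-integrable `[0, T] (EFin \o f) ->
  \int[mu]_(s in `[0, T]) (f s * \int[mu]_(t in `[0, T]) (f t * Num.min s t)) =
  \int[mu]_(t in `[0, T])
    (\int[mu]_(r in `[0, t]) f r - \int[mu]_(r in `[0, T]) f r) ^+ 2.
Proof.
move=> T0 intf; pose A t := \int[mu]_(r in `[0, t]) f r.
have cA := parameterized_integral_continuous T0 intf.
have intA : mu.-integrable `[0, T] (EFin \o A).
  by apply: continuous_compact_integrable => //; exact: segment_compact.
have intAA := integrable_mul_continuous intA cA.
have cI := parameterized_integral_continuous T0 intA.
have cid : {within `[0, T], continuous (id : R -> R)}.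
  by apply: continuous_subspaceT => x; exact: cvg_id.
have int1 := integrable_mul_continuous intf cid.
have int2 := integrable_mul_continuous intf cI.
(* [e1] trades the integral of t f(t) for T A(T) minus the integral of [A]; [e2] trades the integral
   of [f] times the primitive of [A] for A(T) times the integral of [A] minus the integral of A^2.
   Both sides of the goal then involve only [T], A(T) and the integrals of [A] and A^2. *)
have e1 := Rintegral_parts_primitive T0 intf (integrable_cst_segment T 1).
have e2 := Rintegral_parts_primitive T0 intf intA.
rewrite (_ : \int[mu]_(t in `[0, T]) (f t * \int[mu]_(s in `[0, t]) cst 1 s) =
  \int[mu]_(t in `[0, T]) (f t * t)) in e1; last first.
  apply: eq_Rintegral => t; rewrite mem_setE in_itv/= => /andP[t0 _].
  by rewrite Rintegral_cst_segment ?mul1r.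
rewrite (_ : \int[mu]_(t in `[0, T]) (cst 1 t * _) = \int[mu]_(t in `[0, T]) A t)
  in e1; last by apply: eq_Rintegral => t _; rewrite mul1r.
rewrite [\int[mu]_(t in `[0, T]) cst 1 t]Rintegral_cst_segment// mul1r in e1.
transitivity (A T * \int[mu]_(t in `[0, T]) (f t * t) -
    \int[mu]_(t in `[0, T]) (f t * \int[mu]_(s in `[0, t]) A s)).
  rewrite -RintegralZl// -RintegralB//; last exact: integrable_realZl.
  apply: eq_Rintegral => s; rewrite mem_setE in_itv/= => sD.
  by rewrite Rintegral_mul_min// -/(A T); ring.
rewrite -/(A T) (_ : \int[mu]_(t in `[0, T]) (A t - A T) ^+ 2 =
  \int[mu]_(t in `[0, T]) (A t * A t) - (2 * A T) * \int[mu]_(t in `[0, T]) A t + A T ^+ 2 * T).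
  move: e1 e2; rewrite -/(A T) => e1 e2.
  move: (canRL (addrK _) e1) (canRL (addrK _) e2) => -> ->.
  by ring.
rewrite -RintegralZl// -(Rintegral_cst_segment (A T ^+ 2) T0).
have iZ : mu.-integrable `[0, T] (EFin \o (fun t => 2 * A T * A t)).
  exact: integrable_realZl.
rewrite -RintegralB// -RintegralD//; last 2 first.
- exact: integrable_realB.
- exact: integrable_cst_segment.
by apply: eq_Rintegral => t _; ring.
Qed.
Lemma Rintegral_segment_sum n (f : 'I_n -> R -> R) (t : R) :
  (forall j, mu.-integrable `[0, t] (EFin \o f j)) ->
  mu.-integrable `[0, t] (EFin \o (fun s => \sum_(j < n) f j s)) /\
  \int[mu]_(s in `[0, t]) \sum_(j < n) f j s =
  \sum_(j < n) \int[mu]_(s in `[0, t]) f j s.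
Proof.
move=> intf; elim: (index_enum _) => [|j r [IH1 IH2]].
  have -> : (fun s => \sum_(j <- [::]) f j s) = cst 0.
    by apply/funext => s; rewrite big_nil.
  rewrite big_nil Rintegral_cst// mul0r; split => //; exact: integrable_cst_segment.
have -> : (fun s => \sum_(k <- j :: r) f k s) = (fun s => f j s + \sum_(k <- r) f k s).
  by apply/funext => s; rewrite big_cons.
split; first exact: integrable_segmentD.
by rewrite big_cons RintegralD// IH2.
Qed.

End segment_integrals.

(** * Second-order linear equations in integral form *)

Section linear_ode.
Context {R : realType}.
Notation mu := (@lebesgue_measure R).

Lemma eq_Rintegral_ae (D : set R) (f g : R -> R) :
  measurable D -> measurable_fun D f -> measurable_fun D g ->
  {ae mu, forall t, D t -> f t = g t} ->
  \int[mu]_(t in D) f t = \int[mu]_(t in D) g t.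
Proof.
move=> mD mf mg fg; congr fine; apply: ae_eq_integral => //;
  [exact/measurable_EFinP|exact/measurable_EFinP|].
move: fg; apply: filterS; first exact: (ae_filter_ringOfSetsType mu).
by move=> t fg Dt; rewrite fg.
Qed.

Lemma is_derive_primitive (g : R -> R) (c T t : R) :
  0 < t -> t < T -> {within `[0, T], continuous g} ->
  is_derive t 1 (fun s => c + \int[mu]_(r in `[0, s]) g r) (g t).
Proof.
move=> t0 tT cg; have T0 := lt_trans t0 tT.
have intg : mu.-integrable `[0, T] (EFin \o g).
  by apply: continuous_compact_integrable => //; exact: segment_compact.
have cgt : {for t, continuous g}.
  have /(continuous_within_itvP _ T0)[+ _ _] := cg.
  by apply; rewrite in_itv/= t0.
have [dG G'] := continuous_FTC1_closed tT intg t0 cgt.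
apply: is_derive_eq; first by apply: is_deriveD; exact: derivableP dG.
by rewrite add0r -derive1E G'.
Qed.

Lemma derive0_segment_cst (p : R -> R) (T : R) :
  (forall t, 0 < t -> t < T -> is_derive t 1 p 0) ->
  {within `[0, T], continuous p} ->
  forall t, 0 <= t <= T -> p t = p 0.
Proof.
move=> dp cp t /andP[t0 tT].
have [||c _] := @MVT_segment R p (fun=> 0) 0 t t0; last first.
- by rewrite mul0r => /eqP; rewrite subr_eq0 => /eqP.
- by apply: continuous_subspaceW cp; apply: subset_itvl; rewrite bnd_simp.
- by move=> x; rewrite in_itv/= => /andP[x0 xt]; apply: dp => //; exact: lt_le_trans tT.
Qed.

(** The hypothesis is f'' = (r1 + r2) f' - r1 r2 f integrated once, with [K] as integration
    constant, and known only almost everywhere. Its right-hand side [G] is continuous, so replacing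
    [g] by [G] under the integral makes [f] differentiable with derivative [G] on the open interval;
    [G] is then differentiable in turn. *)
Lemma integral_ode_exp (T f0 K r1 r2 : R) (g : R -> R) :
  let f t := f0 + \int[mu]_(s in `[0, t]) g s in
  0 < T -> r1 != r2 -> mu.-integrable `[0, T] (EFin \o g) ->
  {ae mu, forall t, `[0, T]%classic t ->
     g t = K + (r1 + r2) * f t - r1 * r2 * \int[mu]_(s in `[0, t]) f s} ->
  exists c1 c2, forall t, 0 <= t <= T -> f t = c1 * expR (r1 * t) + c2 * expR (r2 * t).
Proof.
move=> f T0 r12 intg gE.
have cf : {within `[0, T], continuous f}.
  have cg := parameterized_integral_continuous (ltW T0) intg.
  apply/subspace_continuousP => x xD; apply: cvgD; first exact: cvg_cst.
  by move/subspace_continuousP: cg; exact.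
have intf : mu.-integrable `[0, T] (EFin \o f).
  by apply: continuous_compact_integrable => //; exact: segment_compact.
pose G t := K + (r1 + r2) * f t - r1 * r2 * \int[mu]_(s in `[0, t]) f s.
have cG : {within `[0, T], continuous G}.
  have cF := parameterized_integral_continuous (ltW T0) intf.
  apply/subspace_continuousP => x xD; apply: cvgB.
    apply: cvgD; first exact: cvg_cst.
    by apply: cvgM; [exact: cvg_cst|move/subspace_continuousP: cf; exact].
  by apply: cvgM; [exact: cvg_cst|move/subspace_continuousP: cF; exact].
have intG : mu.-integrable `[0, T] (EFin \o G).
  by apply: continuous_compact_integrable => //; exact: segment_compact.
have fG t : t <= T -> f t = f0 + \int[mu]_(s in `[0, t]) G s.
  move=> tT; congr (_ + _); apply: eq_Rintegral_ae => //.
  - by apply/measurable_EFinP; apply: (measurable_int mu); exact: integrable_segmentW tT intg.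
  - by apply/measurable_EFinP; apply: (measurable_int mu); exact: integrable_segmentW tT intG.
  - move: gE; apply: filterS; first exact: (ae_filter_ringOfSetsType mu).
    move=> s gE sD; apply: gE; move: sD; rewrite /= !in_itv/=.
    by case/andP=> -> /le_trans ->.
have df t : 0 < t -> t < T -> is_derive t 1 f (G t).
  move=> t0 tT; have := is_derive_primitive f0 t0 tT cG.
  apply: near_eq_is_derive; near=> s; rewrite fG//.
  have : s \in `]0, T[ by near: s; apply: near_in_itvoo; rewrite in_itv/= t0.
  by rewrite in_itv/= => /andP[_ /ltW].
have dG t : 0 < t -> t < T -> is_derive t 1 G ((r1 + r2) * G t - r1 * r2 * f t).
  move=> t0 tT; have d1 := df t t0 tT.
  have := is_derive_primitive 0 t0 tT cf.
  under eq_fun do rewrite add0r.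
  move=> d2; apply: is_derive_eq => /=.
  by rewrite /GRing.scale/=; ring.
(* p := f' - a f solves p' = b p; doing this for both orderings of the roots and
   subtracting eliminates f'. *)
have key a b : a + b = r1 + r2 -> a * b = r1 * r2 -> exists c, forall t, 0 <= t <= T ->
    G t - a * f t = c * expR (b * t).
  move=> ab1 ab2.
  (* The integrating factor [expR (- b * t)] is built into [p], so its derivative vanishes. *)
  pose p t := (G t - a * f t) * expR (- b * t).
  have dp t : 0 < t -> t < T -> is_derive t 1 p 0.
    move=> t0 tT; have d1 := df t t0 tT; have d2 := dG t t0 tT.
    by apply: is_derive_eq; rewrite /GRing.scale/= -ab1 -ab2; ring.
  have cp : {within `[0, T], continuous p}.
    apply/subspace_continuousP => x xD; apply: cvgM.
      apply: cvgB; first by move/subspace_continuousP: cG; exact.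
      by apply: cvgM; [exact: cvg_cst|move/subspace_continuousP: cf; exact].
    apply: (cvg_comp _ expR); last exact: continuous_expR.
    by apply: cvgM; [exact: cvg_cst|exact: cvg_within].
  exists (p 0) => t tD; rewrite -(derive0_segment_cst dp cp tD) /p.
  by rewrite -mulrA -expRD mulNr addNr expR0 mulr1.
have [c1 h1] := key r1 r2 erefl erefl.
have [c2 h2] := key r2 r1 (addrC _ _) (mulrC _ _).
have r0 : r2 - r1 != 0 by rewrite subr_eq0 eq_sym.
exists (- c2 / (r2 - r1)), (c1 / (r2 - r1)) => t tD.
have := h1 t tD; have := h2 t tD => e2 e1.
apply: (mulfI r0); rewrite [RHS](_ : _ = c1 * expR (r2 * t) - c2 * expR (r1 * t)).
  by rewrite -e1 -e2; ring.
by field.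
Unshelve. all: by end_near. Qed.

(** Dividing the terminal condition by exp(r2 T) leaves c1 E + c2 = 0 with E = exp(2 h T), so the
    coefficients depend on the roots only through their half-gap [h]. Positivity of [h] and [T]
    gives E > 1, hence nonzero denominators. *)
Lemma two_exponentials_boundary (T h r1 r2 c1 c2 a : R) :
  0 < T -> 0 < h -> r1 - r2 = 2 * h -> c1 + c2 = a ->
  c1 * expR (r1 * T) + c2 * expR (r2 * T) = 0 ->
  c1 = - a / (expR (2 * h * T) - 1) /\ c2 = a / (1 - expR (- (2 * h * T))).
Proof.
move=> T0 h0 r12 c12 bc.
set E := expR (2 * h * T).
have E1 : 1 < E by rewrite expR_gt1 !mulr_gt0.
have E0 : 0 < E by exact: expR_gt0.
have {}bc : c1 * E + c2 = 0.
  have : expR (r1 * T) = expR (r2 * T) * E.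
    by rewrite /E -expRD -r12; congr expR; ring.
  move=> eE; have e2 : expR (r2 * T) != 0 by rewrite gt_eqF// expR_gt0.
  by apply: (mulfI e2); rewrite mulr0 -bc eE; ring.
have E10 : E - 1 != 0 by rewrite subr_eq0 gt_eqF.
have e1 : c1 = - a / (E - 1).
  by apply: (mulIf E10); rewrite divfK//; lra.
split=> //; rewrite expRN -/E.
have -> : a / (1 - E^-1) = a * E / (E - 1).
  by field; rewrite E10 gt_eqF.
by apply: (mulIf E10); rewrite divfK// -c12; lra.
Qed.

(** The hypotheses on sum and product say that [r1] and [r2] are the roots of a r^2 + b r - c. The
    function [S] is known only on [[0, T]], so its derivatives at interior points are transferred by
    local equality from [F k], the k-th derivative of the combination on the whole line. *)
Lemma exp_combination_ode (S : R -> R) (T a b c1 c2 r1 r2 c : R) :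
  (forall t, 0 <= t <= T -> S t = c1 * expR (r1 * t) + c2 * expR (r2 * t)) ->
  a * (r1 + r2) = - b -> a * (r1 * r2) = - c ->
  forall t, 0 < t < T -> [/\ derivable S t 1, derivable (derive1 S) t 1 &
    c * S t - b * derive1 S t - a * derive1 (derive1 S) t = 0].
Proof.
move=> SE e1 e2 t tD.
pose F k s := c1 * r1 ^+ k * expR (r1 * s) + c2 * r2 ^+ k * expR (r2 * s).
have dF k (s : R) : is_derive s (1 : R) (F k) (F k.+1 s).
  by apply: is_derive_eq; rewrite /F /GRing.scale/= !exprS; ring.
have near_oo (s : R) : 0 < s < T -> \forall y \near s, 0 < y < T.
  move=> sD; have : s \in `]0, T[ by rewrite in_itv.
  move=> /near_in_itvoo; apply: filterS => y; by rewrite in_itv.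
have dS (s : R) : 0 < s < T -> is_derive s (1 : R) S (F 1%N s).
  move=> sD; apply: near_eq_is_derive (dF 0%N s).
  have := near_oo s sD; apply: filterS => y /andP[y0 yT].
  by rewrite SE ?(ltW y0) ?(ltW yT)// /F !expr0 !mulr1.
have dS1 (s : R) : 0 < s < T -> is_derive s (1 : R) (derive1 S) (F 2%N s).
  move=> sD; apply: near_eq_is_derive (dF 1%N s).
  have := near_oo s sD; apply: filterS => y yD.
  by rewrite derive1E; case: (dS y yD) => _ ->.
have [d1 v1] := dS t tD; have [d2 v2] := dS1 t tD.
split=> //; rewrite !derive1E v1 v2 SE; last by case/andP: tD => /ltW -> /ltW ->.
have -> : b = - (a * (r1 + r2)) by rewrite e1 opprK.
have -> : c = - (a * (r1 * r2)) by rewrite e2 opprK.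
by rewrite /F; ring.
Qed.

End linear_ode.

(** * Moments of the centered normal law *)

Section normal_moments.
Context {R : realType}.
Notation mu := (@lebesgue_measure R).

(** Layer-cake argument: the expectation of f(X) is the integral over r >= 0 of P(f(X) > r), each
    probability is an integral of the density, and after Tonelli the integral in [r] of the
    indicator of [[0, f x[] gives back [f x]. *)
Lemma ge0_integral_density d (Omega : measurableType d) (P : probability Omega R)
    (X : Omega -> R) (phi f : R -> R) :
  measurable_fun setT X -> measurable_fun setT phi -> (forall x, 0 <= phi x) ->
  measurable_fun setT f -> (forall x, 0 <= f x) ->
  (forall A, measurable A -> P (X @^-1` A) = \int[mu]_(x in A) (phi x)%:E)%E ->
  (\int[P]_w (f (X w))%:E = \int[mu]_x (f x * phi x)%:E)%E.
Proof.
move=> mX mphi phi0 mf f0 PX.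
have mfX : measurable_fun setT (f \o X) by exact: measurableT_comp.
pose Y : {RV P >-> R} := HB.pack (f \o X) (isMeasurableFun.Build _ _ _ _ _ mfX).
have := @ge0_expectation_ccdf _ _ _ P Y (fun x => f0 (X x)).
rewrite expectation_def /= => ->.
pose h (z : R * R) := phi z.2 * (if (0 <= z.1) && (z.1 < f z.2) then 1 else 0).
have mh : measurable_fun setT h.
  apply: measurable_funM; first exact: measurableT_comp.
  apply: measurable_fun_ifT => //.
  apply: measurable_and; first exact: measurable_fun_ler.
  by apply: measurable_fun_ltr => //; exact: measurableT_comp.
have h0 z : 0 <= h z by rewrite /h mulr_ge0//; case: ifP.
transitivity (\int[mu]_r \int[mu]_x (h (r, x))%:E)%E.
  rewrite integral_mkcond; apply: eq_integral => r _; rewrite patchE.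
  case: ifPn; rewrite mem_setE in_itv/= andbT => r0; last first.
    rewrite integral0_eq// => x _; rewrite /h/= (negbTE r0)/=.
    by rewrite mulr0.
  rewrite /ccdf/= /distribution /pushforward/=.
  rewrite (_ : _ @^-1` _ = X @^-1` (f @^-1` `]r, +oo[)) // PX//; last first.
    by rewrite -[X in measurable X]setTI; exact: mf.
  rewrite integral_mkcond; apply: eq_integral => x _; rewrite patchE /h/= r0/=.
  have -> : (x \in f @^-1` `]r, +oo[) = (r < f x).
    by apply/idP/idP; rewrite inE/= in_itv/= andbT.
  by case: (r < f x); rewrite ?mulr1 ?mulr0.
transitivity (\int[mu]_x \int[mu]_r (h (r, x))%:E)%E.
  have FT := @fubini_tonelli _ _ _ _ _ mu mu (EFin \o h).
  apply FT; first exact/measurable_EFinP.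
  by move=> z; rewrite lee_fin.
apply: eq_integral => x _.
rewrite (_ : (\int[mu]_r _)%E = \int[mu]_r ((phi x)%:E * (\1_`[0, f x[ r)%:E))%E; last first.
  apply: eq_integral => r _; rewrite /h/= -EFinM indicE mem_setE in_itv/=.
  by case: ((0 <= r) && (r < f x)).
rewrite ge0_integralZl//; last 2 first.
- by apply/measurable_EFinP; exact: measurable_indic.
- by rewrite lee_fin.
rewrite integral_indic//= setIT lebesgue_measure_itv/= lte_fin.
case: ltP => [fx|]; first by rewrite sube0 -EFinM mulrC.
by move=> fx; rewrite (_ : f x = 0) ?mul0r ?mule0//; apply/le_anti; rewrite fx f0.
Qed.


Section centered_normal_pdf.
Variable s : R.
Hypothesis s0 : 0 < s.
Let phi := normal_pdf 0 s.

Let phiE x : phi x = normal_peak s * expR (- x ^+ 2 / (s ^+ 2 *+ 2)).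
Proof. by rewrite /phi normal_pdfE ?gt_eqF// /normal_fun subr0. Qed.

Let phi_even x : phi (- x) = phi x.
Proof. by rewrite !phiE sqrrN. Qed.

Let cphi : continuous phi.
Proof. by apply: continuous_normal_pdf; rewrite gt_eqF. Qed.

Let phi_ge0 x : 0 <= phi x.
Proof. exact: normal_pdf_ge0. Qed.

Let mphi : measurable_fun setT phi.
Proof. exact: measurable_normal_pdf. Qed.

Let dphi (x : R) : is_derive x (1 : R) phi (- x / s ^+ 2 * phi x).
Proof.
have -> : phi = fun x => normal_peak s * expR (- x ^+ 2 / (s ^+ 2 *+ 2)).
  by apply/funext => y; exact: phiE.
apply: is_derive_eq; rewrite /GRing.scale/=.
by field; rewrite gt_eqF.
Qed.

(** Read off the antiderivative s^2 x phi(x), whose derivative is (s^2 - x^2) phi(x). The endpoint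
    [n.+1] keeps the segment nondegenerate, as the fundamental theorem requires. *)
Let integral_sqr_phi_segment n :
  (\int[mu]_(x in `[0%R, n.+1%:R]) (x ^+ 2 * phi x)%:E +
   (s ^+ 2 * n.+1%:R * phi n.+1%:R)%:E =
   (s ^+ 2)%:E * \int[mu]_(x in `[0%R, n.+1%:R]) (phi x)%:E)%E.
Proof.
have c1 : continuous (fun x => s ^+ 2 * phi x).
  by move=> x; apply: cvgM; [exact: cvg_cst|exact: cphi].
have c2 : continuous (fun x : R => x ^+ 2 * phi x).
  by move=> x; apply: cvgM; [exact: exprn_continuous|exact: cphi].
have ci (g : R -> R) : continuous g -> mu.-integrable `[0, n.+1%:R] (EFin \o g).
  move=> cg; apply: continuous_compact_integrable; first exact: segment_compact.
  exact: continuous_subspaceT.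
pose F x := s ^+ 2 * x * phi x.
have dF (x : R) : is_derive x (1 : R) F (s ^+ 2 * phi x - x ^+ 2 * phi x).
  have d1 := dphi x; apply: is_derive_eq; rewrite /GRing.scale/=.
  by field; rewrite gt_eqF.
have cF : continuous F.
  move=> x; apply: differentiable_continuous; apply/derivable1_diffP.
  by case: (dF x).
have := @continuous_FTC2 _ (fun x => s ^+ 2 * phi x - x ^+ 2 * phi x) F 0 n.+1%:R.
have -> : F 0 = 0 by rewrite /F mulr0 mul0r.
rewrite sube0 -[(s ^+ 2 * n.+1%:R * phi n.+1%:R)%R]/(F n.+1%:R) => <- //; first last.
- by move=> x _; rewrite derive1E; case: (dF x).
- split; first by move=> x _; case: (dF x).
  + exact/cvg_at_right_filter/cF.
  + exact/cvg_at_left_filter/cF.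
- by apply: continuous_subspaceT => x; apply: cvgB; [exact: c1|exact: c2].
rewrite -integralD//=; [|exact: ci|]; last first.
  by apply: ci => x; apply: cvgB; [exact: c1|exact: c2].
rewrite -integralZl//; last exact: ci.
by apply: eq_integral => x _; rewrite -EFinD addrC subrK EFinM.
Qed.

Let cvg_boundary : s ^+ 2 * n.+1%:R * phi n.+1%:R @[n --> \oo] --> 0.
Proof.
(* With a = 2 s^2, the bound exp(- N^2 / a) <= a / N^2 makes the boundary term at most C / N. *)
pose C := s ^+ 2 * normal_peak s * (s ^+ 2 *+ 2).
apply: (@squeeze_cvgr _ _ _ _ (fun=> 0) (fun n => C * harmonic n)).
- apply: nearW => n; rewrite (mulr_ge0 (mulr_ge0 (sqr_ge0 s) (ler0n _ _)))//=.
  rewrite phiE /C /harmonic/=.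
  set N : R := n.+1%:R; have N0 : 0 < N by rewrite ltr0n.
  set a := s ^+ 2 *+ 2; have a0 : 0 < a by rewrite /a mulrn_wgt0// exprn_gt0.
  have e1 : expR (- N ^+ 2 / a) <= a / N ^+ 2.
    rewrite mulNr expRN -[leRHS]invf_div lef_pV2 ?posrE ?expR_gt0//; last first.
      by rewrite divr_gt0// exprn_gt0.
    by apply: le_trans (expR_ge1Dx _); rewrite lerDr.
  apply: (@le_trans _ _ (s ^+ 2 * N * (normal_peak s * (a / N ^+ 2)))).
    rewrite ler_wpM2l//; first by rewrite mulr_ge0 ?sqr_ge0// ltW.
    by rewrite ler_wpM2l// normal_peak_ge0.
  rewrite [leRHS](_ : _ = s ^+ 2 * N * (normal_peak s * (a / N ^+ 2)))//.
  by field; rewrite gt_eqF.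
- exact: cvg_cst.
- rewrite -[X in _ --> X](mulr0 C); apply: cvgM; first exact: cvg_cst.
  exact: cvg_harmonic.
Qed.

Let integral_halfline (f : R -> R) : measurable_fun setT f -> (forall x, 0 <= f x) ->
  (\int[mu]_(x in `[0%R, n.+1%:R]) (f x)%:E @[n --> \oo] -->
   \int[mu]_(x in `[0%R, +oo[) (f x)%:E)%E.
Proof.
move=> mf f0.
have -> : `[0, +oo[%classic = \bigcup_n `[0, (n.+1%:R : R)]%classic.
  apply/seteqP; split => x /=; last first.
    by case=> n _ /=; rewrite !in_itv/= => /andP[->].
  rewrite in_itv/= andbT => x0; exists (Num.truncn x) => //=; rewrite in_itv/= x0 ltW//.
  exact: truncnS_gt.
apply: ge0_nondecreasing_set_cvg_integral => //.
- move=> m n mn; apply/subsetPset/subset_itvl; rewrite bnd_simp.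
  by rewrite ler_nat ltnS.
- by move=> n; apply/measurable_EFinP; exact: measurable_funTS.
- by move=> n x _; rewrite lee_fin.
Qed.

(** The segment identity passes to the half line by monotone convergence while its boundary term
    tends to zero; evenness of both integrands doubles it, and the density has total mass one. *)
Lemma integral_sqr_normal_pdf : (\int[mu]_x (x ^+ 2 * phi x)%:E = (s ^+ 2)%:E)%E.
Proof.
have msqr : measurable_fun setT (fun x : R => x ^+ 2 * phi x).
  by apply: measurable_funM => //; exact: exprn_measurable.
have sqr_ge x : 0 <= x ^+ 2 * phi x by rewrite mulr_ge0// sqr_ge0.
have H : (\int[mu]_(x in `[0%R, +oo[) (x ^+ 2 * phi x)%:E =
   (s ^+ 2)%:E * \int[mu]_(x in `[0%R, +oo[) (phi x)%:E)%E.
  rewrite -[LHS]adde0.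
  pose u n := (\int[mu]_(x in `[0%R, n.+1%:R]) (x ^+ 2 * phi x)%:E +
    (s ^+ 2 * n.+1%:R * phi n.+1%:R)%:E)%E.
  have l1 : (u @ \oo --> (s ^+ 2)%:E * \int[mu]_(x in `[0%R, +oo[) (phi x)%:E)%E.
    rewrite (_ : u = fun n => ((s ^+ 2)%:E *
      \int[mu]_(x in `[0%R, n.+1%:R]) (phi x)%:E)%E); last first.
      by apply/funext => n; exact: integral_sqr_phi_segment.
    by apply: cvgeZl => //; exact: integral_halfline.
  apply: (cvg_unique _ _ l1) => //.
  apply: cvgeD; first by rewrite fin_num_adde_defl.
    exact: integral_halfline.
  by apply: cvg_EFin; [exact: nearW|exact: cvg_boundary].
have c2 : continuous (fun x : R => x ^+ 2 * phi x).
  by move=> x; apply: cvgM; [exact: exprn_continuous|exact: cphi].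
rewrite ge0_symfun_integralT//; last by move=> x; rewrite /= sqrrN phi_even.
have := @integral_normal_pdf R 0 s.
rewrite -/phi ge0_symfun_integralT// => [E|x]; last by rewrite /= phi_even.
have halfline : [set x : R | 0 <= x] = `[0, +oo[%classic.
  by apply/seteqP; split => x /=; rewrite in_itv/= andbT.
by rewrite halfline H muleCA -halfline E mule1.
Qed.

(** The reflection x -> - x exchanges the positive and the negative part and preserves the even
    density. *)
Lemma integral_pos_neg_normal_pdf :
  (\int[mu]_x (Num.max x 0 * phi x)%:E = \int[mu]_x (Num.max (- x) 0 * phi x)%:E)%E.
Proof.
have m1 : measurable_fun setT (fun x : R => Num.max x 0 * phi x).
  by apply: measurable_funM => //; exact: measurable_maxr.
transitivity (\int[mu]_(x in `[0%R, +oo[) (Num.max x 0 * phi x)%:E)%E.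
  rewrite [RHS]integral_mkcond; apply: eq_integral => x _; rewrite patchE.
  rewrite mem_setE in_itv/= andbT; case: leP => // x0.
  by rewrite mul0r.
rewrite ge0_integration_by_substitution0; last 2 first.
- exact/measurable_EFinP.
- by move=> x; rewrite lee_fin mulr_ge0// le_max lexx orbT.
rewrite [LHS]integral_mkcond; apply: eq_integral => x _; rewrite patchE.
rewrite mem_setE in_itv/= phi_even; case: leP => // x0.
by rewrite (max_idPr _) ?mul0r// lerNl oppr0 ltW.
Qed.

End centered_normal_pdf.
End normal_moments.

Section normal_random_variable.
Context {R : realType} {d : measure_display} {Omega : measurableType d}.
Variables (P : probability Omega R) (X : Omega -> R) (s : R).
Hypotheses (s0 : 0 < s) (mX : measurable_fun setT X).
Hypothesis PX : forall A, measurable A -> P (X @^-1` A) = normal_prob 0 s A.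

Lemma normal_rv_integral_sqr : (\int[P]_w (X w ^+ 2)%:E = (s ^+ 2)%:E)%E.
Proof.
rewrite -(integral_sqr_normal_pdf s0).
apply: (@ge0_integral_density _ _ _ P X (normal_pdf 0 s) (fun x : R => x ^+ 2)) => //.
- exact: measurable_normal_pdf.
- by move=> x; exact: normal_pdf_ge0.
- by move=> x; exact: sqr_ge0.
Qed.

Lemma normal_rv_integrable_sqr : P.-integrable setT (EFin \o (fun w => X w ^+ 2)).
Proof.
apply/integrableP; split.
  by apply/measurable_EFinP; exact: measurable_funX.
under eq_integral do rewrite /= ger0_norm ?sqr_ge0//.
by rewrite normal_rv_integral_sqr ltry.
Qed.

Lemma normal_rv_integrable : P.-integrable setT (EFin \o X).
Proof.
have i1 : P.-integrable setT (EFin \o (fun w => 1 + X w ^+ 2)).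
  have := integrableD measurableT (finite_measure_integrable_cst P 1 measurableT)
    normal_rv_integrable_sqr.
  exact.
apply: le_integrable i1 => //; first exact/measurable_EFinP.
move=> w _; rewrite lee_fin [leRHS]ger0_norm ?addr_ge0 ?sqr_ge0//.
have := sqr_ge0 (`|X w| - 1); rewrite sqrrB1 real_normK ?num_real//.
have := normr_ge0 (X w); nra.
Qed.

(** The density formula covers nonnegative functions only, so it is applied to the positive and the
    negative part separately; symmetry makes the two integrals equal. *)
Lemma normal_rv_mean : \int[P]_w X w = 0.
Proof.
have E (f : R -> R) : measurable_fun setT f -> (forall x, 0 <= f x) ->
    (\int[P]_w (f (X w))%:E = \int[lebesgue_measure]_x (f x * normal_pdf 0 s x)%:E)%E.
  move=> mf f0; apply: ge0_integral_density => //.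
  - exact: measurable_normal_pdf.
  - by move=> x; exact: normal_pdf_ge0.
rewrite /Rintegral integralE.
have -> : (\int[P]_w (fun w => (X w)%:E)^\+ w = \int[P]_w (Num.max (X w) 0)%:E)%E.
  by apply: eq_integral => w _; rewrite funeposE EFin_max.
have -> : (\int[P]_w (fun w => (X w)%:E)^\- w = \int[P]_w (Num.max (- X w) 0)%:E)%E.
  by apply: eq_integral => w _; rewrite funenegE EFin_max.
rewrite (E (fun x => Num.max x 0)); last 2 first.
- exact: measurable_maxr.
- by move=> x; rewrite le_max lexx orbT.
rewrite (E (fun x => Num.max (- x) 0)); last 2 first.
- by apply: measurable_maxr => //; exact: measurableT_comp.
- by move=> x; rewrite le_max lexx orbT.
rewrite (integral_pos_neg_normal_pdf s0).
(* For an infinite [a] as well, [fine] sends the difference to 0. *)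
set a := (\int[_]_x _)%E; case: a => [r| |]//=.
by rewrite subrr.
Qed.
End normal_random_variable.

(** * Integrals against Brownian paths *)

Section joint_measurability.
Context {R : realType} {d : measure_display} {Omega : measurableType d}.

(* Measurability of Caratheodory functions: a process that is measurable at each time and
   has continuous paths is the pointwise limit of its left-endpoint step processes. *)
Lemma measurable_fun_continuous_process (W : R -> Omega -> R) :
  (forall t, measurable_fun setT (W t)) ->
  (forall w, {within `[0, +oo[, continuous (fun t => W t w)}) ->
  measurable_fun setT (fun z : R * Omega => W (Num.max z.1 0) z.2).
Proof.
move=> mW cW.
pose k (m : nat) (t : R) := Num.truncn (Num.max t 0 * m.+1%:R).
pose h (m : nat) (z : R * Omega) := W ((k m z.1)%:R / m.+1%:R) z.2.
apply: (@measurable_fun_cvg _ _ R setT h) => [m|z _].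
  move=> _ Y mY; rewrite setTI.
  (* On each level set of the integer index [k m] the step process is [W] at one fixed time, so the
     preimage is a countable union of measurable rectangles. *)
  have -> : h m @^-1` Y = \bigcup_j ((k m @^-1` [set j]) `*` (W (j%:R / m.+1%:R) @^-1` Y)).
    apply/seteqP; split => [z Yz|z [j _ [/= kj Yz]]].
      by exists (k m z.1).
    by rewrite /h /= kj.
  apply: bigcupT_measurable => j; apply: measurableX; last first.
    by rewrite -[X in measurable X]setTI; exact: mW.
  have -> : k m @^-1` [set j] =
      (fun t : R => (j%:R <= Num.max t 0 * m.+1%:R) && (Num.max t 0 * m.+1%:R < j.+1%:R))
        @^-1` [set true].
    apply/seteqP; split => t /=.
      by move/eqP; rewrite truncn_eq// mulr_ge0// le_max lexx orbT.
    by move=> H; apply/eqP; rewrite truncn_eq// mulr_ge0// le_max lexx orbT.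
  have mM : measurable_fun setT (fun t : R => Num.max t 0 * m.+1%:R).
    by apply: measurable_funM => //; exact: measurable_maxr.
  rewrite -[X in measurable X]setTI.
  apply: measurable_and => //; first exact: measurable_fun_ler.
  exact: measurable_fun_ltr.
case: z => t w /=; set x := Num.max t 0.
have x0 : 0 <= x by rewrite le_max lexx orbT.
pose y m := (k m t)%:R / m.+1%:R : R.
have cy : y @ \oo --> x.
  apply: (@squeeze_cvgr _ _ _ _ (fun m => x - harmonic m) (fun=> x)).
  - apply: nearW => m; rewrite /y /k /harmonic/=.
    have /(truncn_itv)/andP[h1 h2] : 0 <= x * m.+1%:R by rewrite mulr_ge0.
    rewrite ler_pdivrMr ?ltr0n// h1 andbT.
    rewrite ler_pdivlMr ?ltr0n// mulrBl mulVf ?pnatr_eq0// lerBlDr natr1.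
    exact: ltW.
  - rewrite -[X in _ --> X](subr0 x); apply: cvgB; first exact: cvg_cst.
    exact: cvg_harmonic.
  - exact: cvg_cst.
have /subspace_continuousP/(_ x) := cW w.
rewrite /= in_itv/= andbT => /(_ x0) cWx.
apply: (cvg_comp y (W ^~ w) _ cWx).
(* The path converges only within [[0, +oo[]; the grid points [y m] never leave it. *)
move=> A /cy yA; change (\forall m \near \oo, A (y m)).
have {}yA : \forall m \near \oo, `[0, +oo[%classic (y m) -> A (y m) by exact: yA.
apply: filterS yA => m; apply => /=.
by rewrite in_itv/= andbT divr_ge0.
Qed.

End joint_measurability.

(** * Exchanging expectation and time for a random kernel with a deterministic weight *)

Section weighted_fubini.
Context {R : realType} {d : measure_display} {Omega : measurableType d}.
Variable P : probability Omega R.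
Notation mu := (@lebesgue_measure R).
Variables (T C : R) (v : R -> R) (K : Omega -> R -> R).
Hypothesis C0 : 0 <= C.
Hypothesis intv : mu.-integrable `[0, T] (EFin \o v).
Hypothesis mK : measurable_fun setT (fun z : Omega * R => K z.1 z.2).
Hypothesis KC : forall t, 0 <= t <= T -> (\int[P]_w `|K w t|%:E <= C%:E)%E.

Let V := v \_ `[0, T].
Let f (z : Omega * R) := V z.2 * K z.1 z.2.

Let intV : mu.-integrable setT (EFin \o V).
Proof. exact: integrable_patch. Qed.

Let mV : measurable_fun setT V.
Proof. by apply/measurable_EFinP; apply: (measurable_int mu). Qed.

Let mKt t : measurable_fun setT (K ^~ t).
Proof.
have -> : K ^~ t = (fun z : Omega * R => K z.1 z.2) \o (fun w => (w, t)) by [].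
by apply: measurableT_comp => //; exact: measurable_fun_pair.
Qed.

(** The bound [C] on the first absolute moment of [K], uniform in time, reduces integrability on the
    product to that of [v]. As [v] is extended by zero, the bound is called upon only on
    [[0, T]]. *)
Let intf : (P \x mu)%E.-integrable setT (EFin \o f).
Proof.
have mf : measurable_fun setT f by apply: measurable_funM => //; exact: measurableT_comp.
apply/integrable21ltyP; first exact/measurable_EFinP.
apply: (@le_lt_trans _ _ (\int[mu]_t (`|(V t)%:E| * C%:E))%E); last first.
  have iV : mu.-integrable setT (fun t => `|(V t)%:E|)%E by exact: integrable_abse.
  rewrite integralZr// -ge0_fin_numE.
    by rewrite fin_numM//; exact: integrable_fin_num.
  by rewrite mule_ge0 ?integral_ge0.
apply: ge0_le_integral => //.
- by move=> t _; exact: integral_ge0.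
- apply: (measurable_fun_fubini_tonelli_G (abse \o (EFin \o f))) => //.
  by apply: measurableT_comp => //; exact/measurable_EFinP.
  by move=> z; exact: abse_ge0.
- by apply: emeasurable_funM => //; apply: measurableT_comp => //; exact/measurable_EFinP.
- move=> t _; rewrite /f/=.
  under eq_integral do rewrite normrM EFinM.
  rewrite ge0_integralZl//; last first.
    by apply/measurable_EFinP; apply: measurableT_comp => //; exact: mKt.
  rewrite /V patchE; case: ifPn => [|_]; last by rewrite normr0 !mul0e.
  by rewrite mem_setE in_itv/= => tD; rewrite lee_pmul ?KC// integral_ge0.
Qed.

Lemma integrable_weighted_integral :
  P.-integrable setT (EFin \o (fun w => \int[mu]_(t in `[0, T]) (v t * K w t))).
Proof.
have iF := integrable_fubini_F intf.
rewrite (_ : (fun w => _) = fine \o fubini_F mu (EFin \o f)); last first.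
  apply/funext => w; rewrite Rintegral_mkcond; congr fine.
  by apply: eq_integral => t _; rewrite /f /V/= !patchE; case: ifP; rewrite ?mul0r.
apply: le_integrable iF => //.
  apply/measurable_EFinP; apply: measurableT_comp => //.
  exact: (measurable_fubini_F intf).
by move=> w _ /=; case: (fubini_F _ _ _) => [r| |]//=; rewrite normr0 leey.
Qed.

Lemma Rintegral_weighted_integral :
  \int[P]_w \int[mu]_(t in `[0, T]) (v t * K w t) =
  \int[mu]_(t in `[0, T]) (v t * \int[P]_w K w t).
Proof.
transitivity (\int[P]_w \int[mu]_t f (w, t)).
  apply: eq_Rintegral => w _; rewrite Rintegral_mkcond; apply: eq_Rintegral => t _.
  by rewrite /f /V/= !patchE; case: ifP; rewrite ?mul0r.
rewrite (Rintegral_fubini intf) [RHS]Rintegral_mkcond; apply: eq_Rintegral => t _.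
rewrite /f /V/= !patchE; case: ifPn => tD; last first.
  by under eq_Rintegral do rewrite mul0r; rewrite Rintegral_cst// mul0r.
rewrite RintegralZl//; apply/integrableP; split; first exact/measurable_EFinP.
apply: (@le_lt_trans _ _ C%:E); last exact: ltry.
by apply: KC; move: tD; rewrite mem_setE.
Qed.

End weighted_fubini.

(** * Brownian covariance and the variance of integrals against a path *)

Section brownian_moments.
Context {R : realType} {d : measure_display} {Omega : measurableType d}.
Variables (P : probability Omega R) (W : R -> Omega -> R).
Notation mu := (@lebesgue_measure R).
Hypothesis bmW : standard_BM P W.

Lemma bm_measurable t : measurable_fun setT (W t).
Proof. by case: bmW. Qed.

Lemma bm_increment_law s t : 0 <= s -> s < t -> forall A, measurable A ->
  P ((fun w => W t w - W s w) @^-1` A) = normal_prob 0 (Num.sqrt (t - s)) A.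
Proof. by case: bmW => _ _ _ + _; exact. Qed.

Lemma bm_increment_sqr s t : 0 <= s -> s <= t ->
  P.-integrable setT (EFin \o (fun w => (W t w - W s w) ^+ 2)) /\
  \int[P]_w ((W t w - W s w) ^+ 2) = t - s.
Proof.
move=> s0; rewrite le_eqVlt => /predU1P[<-|st].
  have -> : (fun w => (W s w - W s w) ^+ 2) = cst 0.
    by apply/funext => w; rewrite subrr expr0n.
  rewrite subrr; split; first exact: finite_measure_integrable_cst.
  by rewrite Rintegral_cst// mul0r.
have ts0 : 0 < t - s by rewrite subr_gt0.
have q0 : 0 < Num.sqrt (t - s) by rewrite sqrtr_gt0.
have mX : measurable_fun setT (fun w => W t w - W s w).
  by apply: measurable_funB; exact: bm_measurable.
split; first exact: normal_rv_integrable_sqr q0 mX (bm_increment_law s0 st).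
rewrite /Rintegral (normal_rv_integral_sqr q0 mX (bm_increment_law s0 st))/=.
by rewrite sqr_sqrtr// ltW.
Qed.

Lemma bm_from0 t : (fun w => W t w - W 0 w) = W t.
Proof. by apply/funext => w; case: bmW => -> *; rewrite subr0. Qed.

Lemma bm_sqr t : 0 <= t ->
  P.-integrable setT (EFin \o (fun w => W t w ^+ 2)) /\ \int[P]_w (W t w ^+ 2) = t.
Proof.
move=> t0; have := bm_increment_sqr (lexx 0) t0.
by rewrite subr0; under eq_fun do rewrite -[W t _ - W 0 _]/((fun w => W t w - W 0 w) _) bm_from0.
Qed.

Lemma bm_mean t : 0 <= t -> P.-integrable setT (EFin \o W t) /\ \int[P]_w W t w = 0.
Proof.
rewrite le_eqVlt => /predU1P[<-|t0].
  have -> : W 0 = cst 0 by apply/funext => w; case: bmW.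
  split; first exact: finite_measure_integrable_cst.
  by rewrite Rintegral_cst// mul0r.
have q0 : 0 < Num.sqrt t by rewrite sqrtr_gt0.
have L := bm_increment_law (lexx 0) t0; rewrite subr0 bm_from0 in L.
have mX := bm_measurable t.
split; first exact: normal_rv_integrable q0 mX L.
exact: normal_rv_mean q0 mX L.
Qed.

(** Polarization: the product is half of W_s^2 + W_t^2 - (W_t - W_s)^2, whose mean for s <= t is
    half of s + t - (t - s). *)
Lemma bm_covariance s t : 0 <= s -> 0 <= t ->
  P.-integrable setT (EFin \o (fun w => W s w * W t w)) /\
  \int[P]_w (W s w * W t w) = Num.min s t.
Proof.
wlog st : s t / s <= t.
  move=> H s0 t0; case/orP: (le_total s t) => st; first exact: H.
  have := H _ _ st t0 s0; rewrite minC.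
  by under eq_fun do rewrite mulrC.
move=> s0 t0; rewrite (min_idPl st).
have [is2 es2] := bm_sqr s0; have [it2 et2] := bm_sqr t0.
have [id2 ed2] := bm_increment_sqr s0 st.
have i1 : P.-integrable setT (EFin \o (fun w => W s w ^+ 2 + W t w ^+ 2)).
  by have := integrableD measurableT is2 it2.
have i2 : P.-integrable setT
    (EFin \o (fun w => (W s w ^+ 2 + W t w ^+ 2) - (W t w - W s w) ^+ 2)).
  by have := integrableB measurableT i1 id2.
have E : (fun w => W s w * W t w) =
    (fun w => 2^-1 * ((W s w ^+ 2 + W t w ^+ 2) - (W t w - W s w) ^+ 2)).
  by apply/funext => w; field.
rewrite E; split; first by have := integrableZl measurableT 2^-1 i2.
rewrite RintegralZl// RintegralB// RintegralD// es2 et2 ed2.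
by field.
Qed.

(** Time is cut off at 0 because paths are continuous on [[0, +oo[] only; on [[0, T]] the cutoff
    changes nothing. *)
Lemma bm_joint_measurable :
  measurable_fun setT (fun z : Omega * R => W (Num.max z.2 0) z.1).
Proof.
have -> : (fun z : Omega * R => W (Num.max z.2 0) z.1) =
  (fun z : R * Omega => W (Num.max z.1 0) z.2) \o (fun z : Omega * R => (z.2, z.1)) by [].
apply: measurableT_comp; last exact: measurable_fun_pair.
by case: bmW => *; exact: measurable_fun_continuous_process.
Qed.

Lemma bm_path_continuous T w : {within `[0, T], continuous (fun t => W t w)}.
Proof.
case: bmW => _ /(_ w) cW _ _ _; apply: continuous_subspaceW cW.
by apply: subset_itvl; rewrite bnd_simp.
Qed.

Section integral_against_path.
Variables (T : R) (v : R -> R).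
Hypothesis T0 : 0 <= T.
Hypothesis intv : mu.-integrable `[0, T] (EFin \o v).

(** A pathwise Lebesgue integral, which avoids stochastic integration. With X a primitive of [v], it
    corresponds by parts to the Wiener integral of X(T) - X, which explains the variance found in
    [path_integral_sqr]. *)
Definition path_integral (w : Omega) : R := \int[mu]_(t in `[0, T]) (v t * W t w).
Local Notation Z := path_integral.

Let max0 t : 0 <= t <= T -> Num.max t 0 = t.
Proof. by case/andP=> t0 _; exact: max_idPl. Qed.

Let eq_segment (f g : R -> R) : (forall t, 0 <= t <= T -> f t = g t) ->
  \int[mu]_(t in `[0, T]) f t = \int[mu]_(t in `[0, T]) g t.
Proof. by move=> fg; apply: eq_Rintegral => t; rewrite mem_setE in_itv/=; exact: fg. Qed.

Let integrable_path w : mu.-integrable `[0, T] (EFin \o (fun t => v t * W t w)).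
Proof. apply: integrable_mul_continuous => //; exact: bm_path_continuous. Qed.

Let ZE w : Z w = \int[mu]_(t in `[0, T]) (v t * W (Num.max t 0) w).
Proof. by apply: eq_segment => t tD; rewrite max0. Qed.

Let norm_bound (X : Omega -> R) (Y : Omega -> R) : measurable_fun setT X ->
  P.-integrable setT (EFin \o Y) -> (forall w, `|X w| <= Y w) ->
  (\int[P]_w `|X w|%:E <= (\int[P]_w Y w)%:E)%E.
Proof.
move=> mX iY XY; rewrite /Rintegral fineK; last exact: integrable_fin_num.
apply: ge0_le_integral => //.
- by apply/measurable_EFinP; exact: measurableT_comp.
- exact: (measurable_int P).
- by move=> w _; rewrite lee_fin.
Qed.

Lemma path_integral_mean :
  P.-integrable setT (EFin \o Z) /\ \int[P]_w Z w = 0.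
Proof.
(* The constant comes from |W_t| <= 1 + W_t^2 and E[W_t^2] = t <= T. *)
have C0 : 0 <= 1 + T by rewrite addr_ge0.
have B t : 0 <= t <= T -> (\int[P]_w `|W (Num.max t 0) w|%:E <= (1 + T)%:E)%E.
  move=> tD; rewrite max0//; case/andP: tD => t0 tT.
  have [it2 et2] := bm_sqr t0.
  have i1 := finite_measure_integrable_cst P 1 measurableT.
  apply: (@le_trans _ _ (\int[P]_w (1 + W t w ^+ 2))%:E).
    apply: norm_bound => //; first exact: bm_measurable.
      by have := integrableD measurableT i1 it2.
    move=> w; have := sqr_ge0 (`|W t w| - 1); rewrite sqrrB1 real_normK ?num_real//.
    by have := normr_ge0 (W t w); nra.
  rewrite RintegralD// et2 lee_fin Rintegral_cst//= probability_setT/= mulr1.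
  by rewrite lerD2l.
have -> : Z = fun w => \int[mu]_(t in `[0, T]) (v t * W (Num.max t 0) w).
  by apply/funext.
split; first exact: (integrable_weighted_integral C0 intv bm_joint_measurable B).
rewrite (Rintegral_weighted_integral C0 intv bm_joint_measurable B).
rewrite (eq_segment (g := fun=> 0)) ?Rintegral_cst ?mul0r// => t tD.
by rewrite max0// (bm_mean _).2 ?mulr0//; case/andP: tD.
Qed.


Let mul_path s w : W s w * Z w = \int[mu]_(t in `[0, T]) (v t * (W s w * W (Num.max t 0) w)).
Proof.
rewrite /path_integral -RintegralZl//; apply: eq_segment => t tD.
by rewrite max0// mulrCA.
Qed.

Let norm_mul_le s w t : `|W s w * W t w| <= 2^-1 * (W s w ^+ 2 + W t w ^+ 2).
Proof.
rewrite normrM -(real_normK (num_real (W s w))) -(real_normK (num_real (W t w))).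
by have := sqr_ge0 (`|W s w| - `|W t w|); rewrite sqrrB; lra.
Qed.

Let bm_half_sum_sqr s t : 0 <= s -> 0 <= t ->
  P.-integrable setT (EFin \o (fun w => 2^-1 * (W s w ^+ 2 + W t w ^+ 2))) /\
  \int[P]_w (2^-1 * (W s w ^+ 2 + W t w ^+ 2)) = 2^-1 * (s + t).
Proof.
move=> s0 t0; have [is2 es2] := bm_sqr s0; have [it2 et2] := bm_sqr t0.
have i1 := integrable_realD measurableT is2 it2.
split; first exact: integrable_realZl.
by rewrite RintegralZl// RintegralD// es2 et2.
Qed.

Let joint_at s : measurable_fun setT (fun z : Omega * R => W s z.1 * W (Num.max z.2 0) z.1).
Proof.
apply: measurable_funM; last exact: bm_joint_measurable.
by apply: measurableT_comp => //; exact: bm_measurable.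
Qed.

Let mean_mul_path s : 0 <= s <= T ->
  \int[P]_w (W s w * Z w) = \int[mu]_(t in `[0, T]) (v t * Num.min s t).
Proof.
move=> /andP[s0 sT].
have B t : 0 <= t <= T -> (\int[P]_w `|W s w * W (Num.max t 0) w|%:E <= T%:E)%E.
  move=> tD; rewrite max0//; case/andP: tD => t0 tT.
  have [i1 e1] := bm_half_sum_sqr s0 t0.
  apply: le_trans (norm_bound _ i1 _) _.
  - by apply: measurable_funM; exact: bm_measurable.
  - by move=> w; exact: norm_mul_le.
  - by rewrite e1 lee_fin; lra.
under eq_Rintegral do rewrite mul_path.
rewrite (Rintegral_weighted_integral T0 intv (joint_at s) B).
apply: eq_segment => t tD; rewrite max0//; case/andP: tD => t0 tT.
by rewrite (bm_covariance _ _).2.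
Qed.

(** Provides the uniform moment bound for the kernel W_s Z that the Fubini step of
    [path_integral_sqr] asks for. The integrand is dominated through [Q], half the sum of the two
    squares, with mean (s + t) / 2 <= T. *)
Let norm_mul_path_bound s : 0 <= s <= T ->
  (\int[P]_w `|W s w * Z w|%:E <= (T * \int[mu]_(t in `[0, T]) `|v t|)%:E)%E.
Proof.
move=> /andP[s0 sT].
pose Q w t := 2^-1 * (W s w ^+ 2 + W (Num.max t 0) w ^+ 2).
have intnv : mu.-integrable `[0, T] (EFin \o (fun t => `|v t|)).
  by have := integrable_abse intv.
have mQ : measurable_fun setT (fun z : Omega * R => Q z.1 z.2).
  apply: measurable_funM => //; apply: measurable_funD; apply: measurable_funX.
    by apply: measurableT_comp => //; exact: bm_measurable.
  exact: bm_joint_measurable.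
have Q0 w t : 0 <= Q w t by rewrite mulr_ge0// addr_ge0// sqr_ge0.
have B t : 0 <= t <= T -> (\int[P]_w `|Q w t|%:E <= T%:E)%E.
  move=> tD; rewrite /Q max0//; case/andP: tD => t0 tT.
  have [i1 e1] := bm_half_sum_sqr s0 t0.
  apply: le_trans (norm_bound _ i1 _) _.
  - by apply/measurable_EFinP; exact: (measurable_int P).
  - by move=> w; rewrite ger0_norm// mulr_ge0// addr_ge0// sqr_ge0.
  - by rewrite e1 lee_fin; lra.
have iY := integrable_weighted_integral T0 intnv mQ B.
apply: le_trans (norm_bound _ iY _) _.
- apply: measurable_funM; first exact: bm_measurable.
  by apply/measurable_EFinP; apply: (measurable_int P); exact: path_integral_mean.1.
- move=> w; have /subspace_continuousP cp := @bm_path_continuous T w.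
  rewrite mul_path (@eq_segment _ (fun t => v t * (W s w * W t w))) => [|t tD]; last first.
    by rewrite max0.
  rewrite [leRHS](@eq_segment _ (fun t => `|v t| * (2^-1 * (W s w ^+ 2 + W t w ^+ 2))))
    => [|t tD]; last first.
    by rewrite /Q max0.
  have i1 : mu.-integrable `[0, T] (EFin \o (fun t => v t * (W s w * W t w))).
    apply: integrable_mul_continuous => //; apply/subspace_continuousP => x xD.
    by apply: cvgM; [exact: cvg_cst|exact: cp].
  apply: le_trans (le_normr_Rintegral _ i1) _ => //.
  apply: le_Rintegral => //.
  + by have := integrable_abse i1.
  + apply: integrable_mul_continuous => //; apply/subspace_continuousP => x xD.
    apply: cvgM; first exact: cvg_cst.
    by apply: cvgD; [exact: cvg_cst|apply: cvgM; exact: cp].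
  + by move=> t _; rewrite normrM ler_wpM2l//; exact: norm_mul_le.
rewrite (Rintegral_weighted_integral T0 intnv mQ B) lee_fin -RintegralZl//.
rewrite [leLHS](@eq_segment _ (fun t => `|v t| * (2^-1 * (s + t)))); last first.
  move=> t tD; rewrite /Q max0//; case/andP: tD => t0 tT.
  by rewrite (bm_half_sum_sqr _ _).2.
apply: le_Rintegral => //.
- apply: integrable_mul_continuous => //; apply: continuous_subspaceT => x.
  by apply: cvgM; [exact: cvg_cst|apply: cvgD; [exact: cvg_cst|exact: cvg_id]].
- exact: integrable_realZl.
- move=> t /=; rewrite in_itv/= => /andP[t0 tT].
  by rewrite mulrC ler_wpM2r//; lra.
Qed.

(** Writing Z^2 as the integral of v_t W_t Z makes it a weighted integral with random kernel W_t Z.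
    Fubini for this kernel, after Fubini inside E[W_t Z], produces the double integral of v_s v_t
    min(s, t), which [Rintegral_min_kernel] evaluates. *)
Lemma path_integral_sqr :
  P.-integrable setT (EFin \o (fun w => Z w ^+ 2)) /\
  \int[P]_w (Z w ^+ 2) = \int[mu]_(t in `[0, T])
    (\int[mu]_(r in `[0, t]) v r - \int[mu]_(r in `[0, T]) v r) ^+ 2.
Proof.
pose C := T * \int[mu]_(t in `[0, T]) `|v t|.
have C0 : 0 <= C by rewrite mulr_ge0// Rintegral_ge0.
have mZ : measurable_fun setT Z.
  by apply/measurable_EFinP; apply: (measurable_int P); exact: path_integral_mean.1.
have mK : measurable_fun setT (fun z : Omega * R => W (Num.max z.2 0) z.1 * Z z.1).
  by apply: measurable_funM; [exact: bm_joint_measurable|exact: measurableT_comp].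
have B t : 0 <= t <= T -> (\int[P]_w `|W (Num.max t 0) w * Z w|%:E <= C%:E)%E.
  by move=> tD; rewrite max0//; exact: norm_mul_path_bound.
have E : (fun w => Z w ^+ 2) =
    (fun w => \int[mu]_(t in `[0, T]) (v t * (W (Num.max t 0) w * Z w))).
  apply/funext => w; rewrite expr2 {1}/path_integral -RintegralZr//.
  by apply: eq_segment => t tD; rewrite max0// mulrA.
rewrite E; split; first exact: (integrable_weighted_integral C0 intv mK B).
rewrite (Rintegral_weighted_integral C0 intv mK B) -Rintegral_min_kernel//.
by apply: eq_segment => t tD; rewrite max0// mean_mul_path.
Qed.

End integral_against_path.
End brownian_moments.

(** * First-order condition *)

Section first_order.
Context {R : realType}.
Notation mu := (@lebesgue_measure R).

(** Measurability is a separate clause because it does not follow from integrability of the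
    square. *)
Definition square_integrable (T : R) (f : R -> R) : Prop :=
  measurable_fun `[0, T] f /\ mu.-integrable `[0, T] (EFin \o (fun t => f t ^+ 2)).

Lemma integrable_mul_L2 T (f g : R -> R) :
  square_integrable T f -> square_integrable T g ->
  mu.-integrable `[0, T] (EFin \o (fun t => f t * g t)).
Proof.
move=> [mf if2] [mg ig2]; have i2 := integrable_segmentD if2 ig2.
apply: le_integrable i2 => //; first by apply/measurable_EFinP; exact: measurable_funM.
move=> t _; rewrite lee_fin [leRHS]ger0_norm ?addr_ge0 ?sqr_ge0// normrM.
rewrite -(real_normK (num_real (f t))) -(real_normK (num_real (g t))).
by have := sqr_ge0 (`|f t| - `|g t|); rewrite sqrrB; nra.
Qed.

Lemma square_integrableD T (f g : R -> R) :
  square_integrable T f -> square_integrable T g ->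
  square_integrable T (fun t => f t + g t).
Proof.
move=> sf sg; have ifg := integrable_mul_L2 sf sg.
case: sf sg => [mf if2] [mg ig2]; split; first exact: measurable_funD.
have -> : (fun t => (f t + g t) ^+ 2) = (fun t => (f t ^+ 2 + g t ^+ 2) + 2 * (f t * g t)).
  by apply/funext => t; ring.
by apply: integrable_segmentD => //; [exact: integrable_segmentD|exact: integrable_segmentZ].
Qed.

Lemma square_integrableZ T (c : R) (f : R -> R) :
  square_integrable T f -> square_integrable T (fun t => c * f t).
Proof.
move=> [mf if2]; split; first exact: measurable_funM.
have -> : (fun t => (c * f t) ^+ 2) = (fun t => c ^+ 2 * f t ^+ 2).
  by apply/funext => t; rewrite exprMn.
exact: integrable_segmentZ.
Qed.

Lemma square_integrable_continuous T (f : R -> R) :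
  {within `[0, T], continuous f} -> square_integrable T f.
Proof.
move=> cf; split; first exact: subspace_continuous_measurable_fun.
apply: continuous_compact_integrable; first exact: segment_compact.
apply/subspace_continuousP => x xD; apply: cvgM; move/subspace_continuousP: cf; exact.
Qed.

Lemma square_integrable_integrable T (f : R -> R) :
  square_integrable T f -> mu.-integrable `[0, T] (EFin \o f).
Proof.
move=> sf; have c1 : square_integrable T (fun=> 1).
  by apply: square_integrable_continuous; apply: continuous_subspaceT => x; exact: cvg_cst.
have := integrable_mul_L2 sf c1.
by have -> : (fun t => f t * 1) = f by apply/funext => t; rewrite mulr1.
Qed.

Lemma Rintegral_quadratic T (f g h : R -> R) (e : R) :
  mu.-integrable `[0, T] (EFin \o f) -> mu.-integrable `[0, T] (EFin \o g) ->
  mu.-integrable `[0, T] (EFin \o h) ->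
  \int[mu]_(t in `[0, T]) (f t + e * g t + e ^+ 2 * h t) =
  \int[mu]_(t in `[0, T]) f t + e * \int[mu]_(t in `[0, T]) g t
  + e ^+ 2 * \int[mu]_(t in `[0, T]) h t.
Proof.
move=> intf intg inth.
have ig := integrable_segmentZ e intg; have ih := integrable_segmentZ (e ^+ 2) inth.
by rewrite RintegralD ?RintegralD ?RintegralZl//; exact: integrable_segmentD.
Qed.

Lemma integral_sqr_eq0_ae T (f : R -> R) :
  square_integrable T f -> \int[mu]_(t in `[0, T]) f t ^+ 2 <= 0 ->
  {ae mu, forall t, `[0, T]%classic t -> f t = 0}.
Proof.
move=> [mf if2] le0.
have mf2 : measurable_fun `[0, T] (EFin \o (fun t => f t ^+ 2)).
  exact: (measurable_int mu).
have I0 : (\int[mu]_(t in `[0%R, T]) `|(EFin \o (fun t => (f t ^+ 2)%R)) t| = 0)%E.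
  under eq_integral do rewrite /= ger0_norm ?sqr_ge0//.
  rewrite -[LHS]fineK; last exact: integrable_fin_num.
  congr EFin; apply/le_anti; rewrite le0/= fine_ge0//.
  by apply: integral_ge0 => t _; rewrite lee_fin sqr_ge0.
have : ae_eq mu `[0, T]%classic (EFin \o (fun t => f t ^+ 2)) (cst 0%E).
  exact/ae_eq_integral_abs.
apply: filterS.
move=> t /= H /H [] /eqP; rewrite sqrf_eq0 => /eqP; exact.
Qed.

(** Along v + e eta the functional is a quadratic polynomial in [e] whose linear coefficient is
    minus the squared norm [S0] of [eta]; a maximum at e = 0 forces [S0] to vanish, so the gradient
    equals its mean [K] almost everywhere. *)
Lemma first_order_condition (T x lam k : R) (v p : R -> R) :
  let X u t := x + \int[mu]_(s in `[0, t]) u s in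
  let J u := - (\int[mu]_(t in `[0, T]) (u t * p t))
             - lam * \int[mu]_(t in `[0, T]) u t ^+ 2
             - k * \int[mu]_(t in `[0, T]) X u t ^+ 2 in
  0 < T -> square_integrable T p -> square_integrable T v ->
  (forall u, square_integrable T u ->
     \int[mu]_(t in `[0, T]) u t = \int[mu]_(t in `[0, T]) v t -> J u <= J v) ->
  exists K, {ae mu, forall t, `[0, T]%classic t ->
    p t + 2 * lam * v t - 2 * k * \int[mu]_(s in `[0, t]) X v s = K}.
Proof.
move=> X J T0 sp sv Jmax.
have intv := square_integrable_integrable sv.
have cX u : mu.-integrable `[0, T] (EFin \o u) -> {within `[0, T], continuous (X u)}.
  move=> iu; have cu := parameterized_integral_continuous (ltW T0) iu.
  apply/subspace_continuousP => y yD; apply: cvgD; first exact: cvg_cst.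
  by move/subspace_continuousP: cu; exact.
have intX : mu.-integrable `[0, T] (EFin \o X v).
  by apply/square_integrable_integrable/square_integrable_continuous/cX.
pose G t := p t + 2 * lam * v t + (- (2 * k)) * \int[mu]_(s in `[0, t]) X v s.
have sI : square_integrable T (fun t => \int[mu]_(s in `[0, t]) X v s).
  exact/square_integrable_continuous/(parameterized_integral_continuous (ltW T0) intX).
have sG : square_integrable T G.
  apply: square_integrableD => //; last exact: square_integrableZ.
  by apply: square_integrableD => //; exact: square_integrableZ.
(* G is the gradient of -J; perturb v along its projection eta on mean-zero directions. *)
pose K := (\int[mu]_(t in `[0, T]) G t) / T.
pose eta t := G t + - K.
have sK : square_integrable T (fun=> - K).
  by apply: square_integrable_continuous; apply: continuous_subspaceT => y; exact: cvg_cst.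
have seta : square_integrable T eta by exact: square_integrableD.
have inteta := square_integrable_integrable seta.
have eta0 : \int[mu]_(t in `[0, T]) eta t = 0.
  rewrite RintegralD//; [|exact: square_integrable_integrable..].
  by rewrite Rintegral_cst_segment ?ltW// mulNr /K divfK ?subrr// gt_eqF.
pose A t := \int[mu]_(s in `[0, t]) eta s.
have cA := parameterized_integral_continuous (ltW T0) inteta.
have sA := square_integrable_continuous cA.
have sX := square_integrable_continuous (cX v intv).
(* The boundary term is absent because [eta] has zero mean. This puts the variation of the risk term
   in the form of a pairing with [eta]. *)
have parts : \int[mu]_(t in `[0, T]) (X v t * A t) =
    - \int[mu]_(t in `[0, T]) (eta t * \int[mu]_(s in `[0, t]) X v s).
  have := Rintegral_parts_primitive (ltW T0) inteta intX.
  rewrite eta0 mul0r addrC => /eqP; rewrite addr_eq0 => /eqP; exact.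
(* Only one factor of the square is expanded as [G - K]; the term in [K] drops, and the rest is
   minus the first variation of [J] along [eta]. *)
have S : \int[mu]_(t in `[0, T]) eta t ^+ 2 =
    \int[mu]_(t in `[0, T]) (eta t * p t) + 2 * lam * \int[mu]_(t in `[0, T]) (v t * eta t)
    + 2 * k * \int[mu]_(t in `[0, T]) (X v t * A t).
  rewrite parts.
  have i1 := integrable_mul_L2 seta sp.
  have i2 := integrable_segmentZ (2 * lam) (integrable_mul_L2 sv seta).
  have i3 := integrable_segmentZ (- (2 * k)) (integrable_mul_L2 seta sI).
  have i4 := integrable_segmentZ (- K) inteta.
  have i12 := integrable_segmentD i1 i2.
  have i123 := integrable_segmentD i12 i3.
  transitivity (\int[mu]_(t in `[0, T]) (eta t * p t + 2 * lam * (v t * eta t) +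
     - (2 * k) * (eta t * \int[mu]_(s in `[0, t]) X v s) + (- K) * eta t)).
    by apply: eq_Rintegral => t _; rewrite expr2 {2}/eta /G; ring.
  rewrite RintegralD// RintegralD// RintegralD// !RintegralZl ?eta0//; last 2 first.
  - exact: integrable_mul_L2.
  - exact: integrable_mul_L2.
  by ring.
set S0 := \int[mu]_(t in `[0, T]) eta t ^+ 2 in S.
pose M := lam * S0 + k * \int[mu]_(t in `[0, T]) (A t * A t).
have XD e t : 0 <= t <= T -> X (fun s => v s + e * eta s) t = X v t + e * A t.
  case/andP=> t0 tT; have iv := integrable_segmentW tT intv.
  have ie := integrable_segmentW tT inteta.
  by rewrite /X RintegralD ?RintegralZl ?addrA//; exact: integrable_segmentZ.
have Jquad e : J (fun t => v t + e * eta t) = J v - e * S0 - e ^+ 2 * M.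
  have ivp := integrable_mul_L2 sv sp; have iep := integrable_mul_L2 seta sp.
  have ive := integrable_mul_L2 sv seta; have iXA := integrable_mul_L2 sX sA.
  rewrite /J (_ : \int[mu]_(t in `[0, T]) ((v t + e * eta t) * p t) =
    \int[mu]_(t in `[0, T]) (v t * p t) + e * \int[mu]_(t in `[0, T]) (eta t * p t)); last first.
    rewrite -RintegralZl// -RintegralD//; last exact: integrable_segmentZ.
    by apply: eq_Rintegral => t _; ring.
  rewrite (_ : \int[mu]_(t in `[0, T]) (v t + e * eta t) ^+ 2 =
    \int[mu]_(t in `[0, T]) v t ^+ 2 + e * \int[mu]_(t in `[0, T]) (2 * (v t * eta t))
    + e ^+ 2 * S0); last first.
    rewrite -Rintegral_quadratic ?sv.2 ?seta.2//; last exact: integrable_segmentZ.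
    by apply: eq_Rintegral => t _; ring.
  rewrite (_ : \int[mu]_(t in `[0, T]) X (fun t => v t + e * eta t) t ^+ 2 =
    \int[mu]_(t in `[0, T]) X v t ^+ 2 + e * \int[mu]_(t in `[0, T]) (2 * (X v t * A t))
    + e ^+ 2 * \int[mu]_(t in `[0, T]) (A t * A t)); last first.
    rewrite -Rintegral_quadratic ?sX.2//; last 2 first.
    - exact: integrable_segmentZ.
    - exact: integrable_mul_L2.
    by apply: eq_Rintegral => t; rewrite mem_setE in_itv/= => tD; rewrite XD//; ring.
  rewrite !RintegralZl// /M S; ring.
(* Maximality is tested at v - e eta, where the value changes by e S0 - e^2 M. *)
have S0le e : e * S0 <= e ^+ 2 * M.
  have : J (fun t => v t + (- e) * eta t) <= J v.
    apply: Jmax; first by apply: square_integrableD => //; exact: square_integrableZ.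
    by rewrite RintegralD ?RintegralZl ?eta0 ?mulr0 ?addr0//; exact: integrable_segmentZ.
  by rewrite Jquad sqrrN; lra.
exists K.
have : S0 <= 0.
  rewrite leNgt; apply/negP => S0gt.
  (* For M <= 0 the unit step already contradicts S0 > 0. Otherwise e = S0 / (2 M) gives e S0 <= e
     S0 / 2. *)
  have [M0|M0] := leP M 0; first by have := S0le 1; nra.
  have := S0le (S0 / (2 * M)).
  rewrite (_ : (S0 / (2 * M)) ^+ 2 * M = (S0 / (2 * M)) * (S0 / 2)); last first.
    by field; rewrite gt_eqF.
  rewrite ler_pM2l; first by lra.
  by rewrite divr_gt0// mulr_gt0.
move=> /(integral_sqr_eq0_ae seta).
apply: filterS; first exact: (ae_filter_ringOfSetsType mu).
by move=> t H /H /eqP; rewrite subr_eq0 => /eqP <-; rewrite /G mulNr.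
Qed.
End first_order.

(** * The mean-variance functional *)

Section mean_variance.
Context {R : realType} {d : measure_display} {Omega : measurableType d}.
Variables (P : probability Omega R) (W : R -> Omega -> R).
Notation mu := (@lebesgue_measure R).

Lemma mean_var_affine (alpha D sigma : R) (Z : Omega -> R) :
  P.-integrable setT (EFin \o Z) -> \int[P]_w Z w = 0 ->
  P.-integrable setT (EFin \o (fun w => Z w ^+ 2)) ->
  mean_var P alpha (fun w => D - sigma * Z w) =
  (D - alpha / 2 * sigma ^+ 2 * \int[P]_w (Z w ^+ 2))%:E.
Proof.
move=> iZ eZ iZ2.
have isZ := integrable_realZl measurableT iZ sigma.
have iD := finite_measure_integrable_cst P D measurableT.
have E1 : ('E_P[fun w => (D - sigma * Z w)%R] = D%:E)%E.
  rewrite unlock -[LHS]fineK; last first.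
    by apply: integrable_fin_num => //; exact: integrable_realB.
  congr EFin; rewrite -/(Rintegral _ _ _) RintegralB// RintegralZl// eZ mulr0 subr0.
  by rewrite Rintegral_cst//= probability_setT/= mulr1.
have E2 : ('V_P[fun w => (D - sigma * Z w)%R] = (sigma ^+ 2 * \int[P]_w (Z w ^+ 2))%R%:E)%E.
  rewrite /variance unlock E1/= unlock -RintegralZl//.
  rewrite /Rintegral fineK; last first.
    by apply: integrable_fin_num => //; exact: integrable_realZl.
  by apply: eq_integral => w _; rewrite /= !fctE/=; congr EFin; ring.
by rewrite /mean_var E1 E2 -EFinM -EFinB mulrA.
Qed.

Lemma admissible_square_integrable (T x : R) (v : R -> R) :
  admissible T x v <->
  square_integrable T v /\ \int[mu]_(t in `[0, T]) v t = - x.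
Proof.
split=> [[iv iv2 ev]|[sv ev]].
- split; last by rewrite -(addKr x (\int[mu]_(t in `[0, T]) v t)) ev addr0.
  split=> //; apply/measurable_EFinP; exact: (measurable_int mu).
- split; [exact: square_integrable_integrable|exact: sv.2|].
  by rewrite ev subrr.
Qed.

Section agent.
Variables (T S0 sigma gamma lambda alpha : R) (n : nat) (xs : 'I_n -> R)
  (vs : 'I_n -> R -> R) (i : 'I_n).
Hypothesis T0 : 0 <= T.
Hypothesis bmW : standard_BM P W.
Hypothesis adm : forall j, admissible T (xs j) (vs j).

Let Y t := \sum_(j < n | j != i) \int[mu]_(s in `[0, t]) vs j s.
Let u t := \sum_(j < n | j != i) vs j t.

(** The part of the price caused by the other agents: a deterministic function that stays fixed
    while agent [i] deviates. *)
Definition others_impact t : R := gamma * Y t + lambda * u t.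

Lemma square_integrable_others_impact : square_integrable T others_impact.
Proof.
have sv j : square_integrable T (vs j).
  by have /admissible_square_integrable[] := adm j.
have s0 : square_integrable T (fun=> 0).
  by apply: square_integrable_continuous; apply: continuous_subspaceT => x; exact: cvg_cst.
have ssum (f : 'I_n -> R -> R) : (forall j, square_integrable T (f j)) ->
    square_integrable T (fun t => \sum_(j < n | j != i) f j t).
  move=> sf; elim: (index_enum _) => [|j r IH].
    have -> : (fun t => \sum_(j <- [::] | j != i) f j t) = (fun=> 0).
      by apply/funext => t; rewrite big_nil.
    exact: s0.
  have -> : (fun t => \sum_(k <- j :: r | k != i) f k t) =
      (fun t => (if j != i then f j t else 0) + \sum_(k <- r | k != i) f k t).
    by apply/funext => t; rewrite big_cons; case: ifP; rewrite ?add0r.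
  by apply: square_integrableD => //; case: (j != i).
apply: square_integrableD; apply: square_integrableZ; apply: ssum => // j.
apply: square_integrable_continuous.
by apply: parameterized_integral_continuous => //; exact: square_integrable_integrable.
Qed.

(** The unaffected initial price and the own permanent impact contribute constants, because the
    integral of [v] is [- xs i] and that of [v] times its primitive is half its square. Hence
    [gamma] influences the optimization only through [others_impact]. *)
Lemma mean_var_revenue v : admissible T (xs i) v ->
  mean_var P alpha (revenue W T S0 sigma gamma lambda xs (upd vs i v) i) =
  (S0 * xs i - gamma * (xs i ^+ 2 / 2)
   - (\int[mu]_(t in `[0, T]) (v t * others_impact t))
   - lambda * (\int[mu]_(t in `[0, T]) v t ^+ 2)
   - alpha / 2 * sigma ^+ 2 * \int[mu]_(t in `[0, T]) pos (xs i) v t ^+ 2)%:E.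
Proof.
move=> /admissible_square_integrable[sv ev].
have iv := square_integrable_integrable sv.
have iv2 := sv.2.
have cA := parameterized_integral_continuous T0 iv.
have iA := integrable_mul_continuous iv cA.
have io := integrable_mul_L2 sv square_integrable_others_impact.
have parts : \int[mu]_(t in `[0, T]) (v t * \int[mu]_(s in `[0, t]) v s) = xs i ^+ 2 / 2.
  by have := Rintegral_parts_primitive T0 iv iv; rewrite ev mulrNN => H; lra.
set D := S0 * xs i - gamma * (xs i ^+ 2 / 2)
   - (\int[mu]_(t in `[0, T]) (v t * others_impact t))
   - lambda * (\int[mu]_(t in `[0, T]) v t ^+ 2).
have revE : revenue W T S0 sigma gamma lambda xs (upd vs i v) i =
    (fun w => D - sigma * path_integral W T v w).
  apply/funext => w; rewrite /revenue.
  have iW : mu.-integrable `[0, T] (EFin \o (fun t => v t * W t w)).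
    by apply: integrable_mul_continuous => //; exact: bm_path_continuous bmW _ _.
  have i1 := integrable_segmentZ S0 iv; have i2 := integrable_segmentZ sigma iW.
  have i3 := integrable_segmentZ gamma iA; have i4 := integrable_segmentZ lambda iv2.
  have i12 := integrable_segmentD i1 i2; have i123 := integrable_segmentD i12 i3.
  have i1234 := integrable_segmentD i123 i4.
  rewrite (_ : \int[mu]_(t in `[0, T]) _ = \int[mu]_(t in `[0, T])
     (S0 * v t + sigma * (v t * W t w) + gamma * (v t * \int[mu]_(s in `[0, t]) v s)
      + lambda * v t ^+ 2 + v t * others_impact t)); last first.
    apply: eq_Rintegral => t _.
    rewrite /price /pos (bigD1 i)//= (bigD1 i (P := predT))//= /upd eqxx.
    rewrite (eq_bigr (fun j => \int[mu]_(s in `[0, t]) vs j s)); last first.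
      by move=> j /negbTE ->; rewrite addrC addKr.
    rewrite [X in lambda * (_ + X)](eq_bigr (fun j => vs j t)); last first.
      by move=> j /negbTE ->.
    by rewrite /others_impact /Y /u; ring.
  rewrite !RintegralD// !RintegralZl// parts ev /D /path_integral; ring.
have [iZ eZ] := path_integral_mean bmW T0 iv.
have [iZ2 eZ2] := path_integral_sqr bmW T0 iv.
rewrite revE mean_var_affine// eZ2 /D; congr (_ - _ * _)%:E.
(* As [v] integrates to [- xs i], the primitive minus its final value is the position. *)
by apply: eq_Rintegral => t _; rewrite ev opprK addrC.
Qed.

End agent.
End mean_variance.

(** * The equilibrium *)

Section equilibrium.
Context {R : realType} {d : measure_display} {Omega : measurableType d}.
Variables (P : probability Omega R) (W : R -> Omega -> R).
Notation mu := (@lebesgue_measure R).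
Variables (T S0 sigma gamma lambda alpha : R) (n : nat) (xs : 'I_n -> R)
  (vs : 'I_n -> R -> R).
Hypothesis T0 : 0 < T.
Hypothesis bmW : standard_BM P W.
Hypothesis nash : nash_mv P W T S0 sigma gamma lambda (fun=> alpha) xs vs.

Lemma upd_id (i : 'I_n) : upd vs i (vs i) = vs.
Proof. by apply/funext => j; rewrite /upd; case: eqP => [->|]. Qed.

(** The own rate enters with weight 2 lambda; one share is absorbed into the sum over all agents, a
    form in which the equations can be added and compared. *)
Lemma nash_euler_lagrange i : exists K, {ae mu, forall t, `[0, T]%classic t ->
  lambda * (\sum_(j < n) vs j t + vs i t) +
  gamma * (\sum_(j < n) \int[mu]_(s in `[0, t]) vs j s - \int[mu]_(s in `[0, t]) vs i s)
  - alpha * sigma ^+ 2 * \int[mu]_(s in `[0, t]) pos (xs i) (vs i) s = K}.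
Proof.
have adm j : admissible T (xs j) (vs j) by case: (nash j).
have [svi evi] := (admissible_square_integrable _ _ _).1 (adm i).
have sp := square_integrable_others_impact gamma lambda i (ltW T0) adm.
have [|K HK] := @first_order_condition R T (xs i) lambda (alpha / 2 * sigma ^+ 2)
    (vs i) _ T0 sp svi.
  move=> u su eu.
  have au : admissible T (xs i) u.
    by apply/admissible_square_integrable; rewrite -evi.
  have [_ /(_ u au)] := nash i.
  (* The equilibrium is read as the trivial deviation to [vs i], so one formula evaluates both
     sides. *)
  rewrite -{2}(upd_id i) !(mean_var_revenue S0 sigma gamma lambda alpha (ltW T0) bmW adm)//.
  by rewrite lee_fin /pos; lra.
exists K; move: HK; apply: filterS; first exact: (ae_filter_ringOfSetsType mu).
move=> t /[apply] <-; rewrite /others_impact (bigD1 i)//= (bigD1 i (P := predT))//=.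
by rewrite /pos; lra.
Qed.

End equilibrium.

(** * Linear equations for the total position and for deviations from the mean *)

Section equilibrium_positions.
Context {R : realType} {d : measure_display} {Omega : measurableType d}.
Variables (P : probability Omega R) (W : R -> Omega -> R).
Notation mu := (@lebesgue_measure R).
Variables (T S0 sigma gamma lambda alpha : R) (n : nat) (xs : 'I_n -> R)
  (vs : 'I_n -> R -> R).
Hypotheses (T0 : 0 < T) (lambda0 : 0 < lambda) (n0 : (0 < n)%N).
Hypothesis bmW : standard_BM P W.
Hypothesis nash : nash_mv P W T S0 sigma gamma lambda (fun=> alpha) xs vs.

Let X j t := pos (xs j) (vs j) t.
Let N : R := n%:R.

Let N0 : 0 < N. Proof. by rewrite ltr0n. Qed.

Let intv j t : t <= T -> mu.-integrable `[0, t] (EFin \o vs j).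
Proof. by move=> tT; apply: integrable_segmentW tT _; case: (nash j) => -[]. Qed.

Let intX j t : t <= T -> mu.-integrable `[0, t] (EFin \o X j).
Proof.
move=> tT; apply: integrable_segmentW tT _; apply: square_integrable_integrable.
apply: square_integrable_continuous.
have cA := parameterized_integral_continuous (ltW T0) (intv j (lexx T)).
apply/subspace_continuousP => y yD; apply: cvgD; first exact: cvg_cst.
by move/subspace_continuousP: cA; exact.
Qed.

Lemma nash_position0 j : pos (xs j) (vs j) 0 = xs j.
Proof. by rewrite /pos set_itv1 Rintegral_set1 addr0. Qed.

Lemma nash_positionT j : pos (xs j) (vs j) T = 0.
Proof. by case: (nash j) => -[]. Qed.

Let total t := \sum_(j < n) X j t.

Let totalE t : t <= T ->
  total t = \sum_(j < n) xs j + \int[mu]_(s in `[0, t]) \sum_(j < n) vs j s.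
Proof.
move=> tT; rewrite (Rintegral_segment_sum (fun j => intv j tT)).2.
by rewrite /total /X /pos big_split.
Qed.

Let int_total t : t <= T -> \int[mu]_(s in `[0, t]) total s =
  \sum_(j < n) \int[mu]_(s in `[0, t]) X j s.
Proof. by move=> tT; rewrite (Rintegral_segment_sum (fun j => intX j tT)).2. Qed.

Let sum_primitive t : \sum_(j < n) \int[mu]_(s in `[0, t]) vs j s =
  total t - \sum_(j < n) xs j.
Proof. by rewrite /total /X /pos big_split/= [RHS]addrC addKr. Qed.

(** With finitely many agents, one null set serves them all, so the equations can be combined at a
    common time. Passing from primitives to positions shifts only the constants. *)
Let euler_lagrange : exists K : 'I_n -> R, {ae mu, forall t, forall i, `[0, T]%classic t ->
  lambda * (\sum_(j < n) vs j t + vs i t) + gamma * (total t - X i t)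
  - alpha * sigma ^+ 2 * \int[mu]_(s in `[0, t]) X i s = K i}.
Proof.
have [K HK] := choice (nash_euler_lagrange T0 bmW nash).
exists (fun i => K i + gamma * (\sum_(j < n) xs j - xs i)).
have : {ae mu, forall t, forall i, `[0, T]%classic t ->
  lambda * (\sum_(j < n) vs j t + vs i t) +
  gamma * (\sum_(j < n) \int[mu]_(s in `[0, t]) vs j s - \int[mu]_(s in `[0, t]) vs i s)
  - alpha * sigma ^+ 2 * \int[mu]_(s in `[0, t]) pos (xs i) (vs i) s = K i}.
  by apply: filter_forall.
apply: filterS; first exact: (ae_filter_ringOfSetsType mu).
move=> t H i /(H i) <-; by rewrite sum_primitive /X /pos; ring.
Qed.

(** In the sum of all equations each rate occurs n times in the common sums and once on its own,
    hence N + 1; each position occurs n times and is subtracted once, hence N - 1. *)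
Lemma nash_total_exp (r1 r2 : R) : r1 != r2 ->
  (N + 1) * lambda * (r1 + r2) = - ((N - 1) * gamma) ->
  (N + 1) * lambda * (r1 * r2) = - (alpha * sigma ^+ 2) ->
  exists c1 c2, forall t, 0 <= t <= T ->
    \sum_(j < n) pos (xs j) (vs j) t = c1 * expR (r1 * t) + c2 * expR (r2 * t).
Proof.
move=> r12 e1 e2; have [K HK] := euler_lagrange.
have cN : (N + 1) * lambda != 0 by rewrite mulf_neq0// gt_eqF// addr_gt0.
have iV := (Rintegral_segment_sum (fun j => intv j (lexx T))).1.
have [|c1 [c2 H]] := @integral_ode_exp R T (\sum_(j < n) xs j)
    ((\sum_(j < n) K j) / ((N + 1) * lambda)) r1 r2 _ T0 r12 iV.
  move: HK; apply: filterS; first exact: (ae_filter_ringOfSetsType mu).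
  move=> t EL tD.
  have tT : t <= T by move: tD; rewrite /= in_itv/= => /andP[].
  rewrite -totalE//.
  rewrite (_ : \int[mu]_(s in `[0, t]) _ = \int[mu]_(s in `[0, t]) total s); last first.
    apply: eq_Rintegral => s; rewrite mem_setE in_itv/= => /andP[_ /le_trans sT].
    by rewrite -totalE// sT.
  have : \sum_(i < n) (lambda * (\sum_(j < n) vs j t + vs i t) + gamma * (total t - X i t)
    - alpha * sigma ^+ 2 * \int[mu]_(s in `[0, t]) X i s) = \sum_(i < n) K i.
    by apply: eq_bigr => i _; rewrite EL.
  rewrite big_split/= big_split/= -!mulr_sumr sumrN -mulr_sumr -int_total//.
  rewrite big_split/= sumrB !sumr_const card_ord
    -[(\sum_(j < n) vs j t) *+ n]mulr_natl -[total t *+ n]mulr_natl -/N -/(total t) => <-.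
  apply: (mulfI cN); set q := (X in X / _ + _ - _).
  rewrite (_ : _ * (q / _ + _ - _) = q + (N + 1) * lambda * (r1 + r2) * total t
    - (N + 1) * lambda * (r1 * r2) * \int[mu]_(s in `[0, t]) total s).
    by rewrite e1 e2 /q; ring.
  by field; rewrite !gt_eqF// addr_gt0.
by exists c1, c2 => t tD; rewrite -H// -totalE//; case/andP: tD.
Qed.

(** Subtracting the averaged equation from the i-th cancels all common sums. What remains of the
    [gamma] term is minus the deviation, so the roots sum to [gamma / lambda], with the sign
    opposite to that of the total. *)
Lemma nash_deviation_exp i (r1 r2 : R) : r1 != r2 ->
  lambda * (r1 + r2) = gamma -> lambda * (r1 * r2) = - (alpha * sigma ^+ 2) ->
  exists c1 c2, forall t, 0 <= t <= T ->
    pos (xs i) (vs i) t - (\sum_(j < n) pos (xs j) (vs j) t) / N =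
    c1 * expR (r1 * t) + c2 * expR (r2 * t).
Proof.
move=> r12 e1 e2; have [K HK] := euler_lagrange.
have NN0 : N != 0 by rewrite gt_eqF.
have iV t : t <= T -> mu.-integrable `[0, t] (EFin \o (fun s => \sum_(j < n) vs j s)).
  by move=> tT; exact: (Rintegral_segment_sum (fun j => intv j tT)).1.
have iVN t : t <= T -> mu.-integrable `[0, t]
    (EFin \o (fun s => - N^-1 * \sum_(j < n) vs j s)).
  by move=> tT; apply: integrable_segmentZ; exact: iV.
pose g s := vs i s + - N^-1 * \sum_(j < n) vs j s.
have ig : mu.-integrable `[0, T] (EFin \o g).
  by apply: integrable_segmentD; [exact: intv|exact: iVN].
have fE t : t <= T -> xs i - (\sum_(j < n) xs j) / N + \int[mu]_(s in `[0, t]) g s =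
    X i t - total t / N.
  move=> tT; rewrite RintegralD//; [|exact: intv|exact: iVN].
  rewrite RintegralZl//; last exact: iV.
  by rewrite totalE// /X /pos; field.
have intf t : t <= T -> \int[mu]_(s in `[0, t]) (X i s - total s / N) =
    \int[mu]_(s in `[0, t]) X i s - (\int[mu]_(s in `[0, t]) total s) / N.
  move=> tT; have iT := (Rintegral_segment_sum (fun j => intX j tT)).1.
  under eq_Rintegral do rewrite mulrC -mulNr.
  rewrite RintegralD//; [|exact: intX|exact: integrable_segmentZ].
  by rewrite RintegralZl// mulNr mulrC.
have [|c1 [c2 H]] := @integral_ode_exp R T (xs i - (\sum_(j < n) xs j) / N)
    ((K i - (\sum_(j < n) K j) / N) / lambda) r1 r2 g T0 r12 ig.
  move: HK; apply: filterS; first exact: (ae_filter_ringOfSetsType mu).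
  move=> t EL tD.
  have tT : t <= T by move: tD; rewrite /= in_itv/= => /andP[].
  rewrite fE//.
  rewrite (_ : \int[mu]_(s in `[0, t]) _ =
    \int[mu]_(s in `[0, t]) (X i s - total s / N)); last first.
    apply: eq_Rintegral => s; rewrite mem_setE in_itv/= => /andP[_ /le_trans sT].
    by rewrite fE// sT.
  rewrite intf// -(EL i tD).
  have <- : \sum_(i < n) (lambda * (\sum_(j < n) vs j t + vs i t) + gamma * (total t - X i t)
    - alpha * sigma ^+ 2 * \int[mu]_(s in `[0, t]) X i s) = \sum_(i < n) K i.
    by apply: eq_bigr => j _; rewrite EL.
  rewrite big_split/= big_split/= -!mulr_sumr sumrN -mulr_sumr -int_total//.
  rewrite big_split/= sumrB !sumr_const card_ord
    -[(\sum_(j < n) vs j t) *+ n]mulr_natl -[total t *+ n]mulr_natl -/N -/(total t) /g.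
  have -> : gamma = lambda * (r1 + r2) by [].
  have -> : alpha * sigma ^+ 2 = - (lambda * (r1 * r2)) by rewrite e2 opprK.
  by field; rewrite !gt_eqF.
exists c1, c2 => t tD; rewrite -H// fE//; by case/andP: tD.
Qed.

End equilibrium_positions.

(** * Identification of the roots and of the coefficients *)

Theorem theorem2p5 (R : realType) (d : measure_display) (Omega : measurableType d)
  (P : probability Omega R) (W : R -> Omega -> R)
  (T S0 sigma gamma lambda alpha : R) (n : nat) (xs : 'I_n -> R)
  (vs : 'I_n -> R -> R) :
  0 < T -> 0 <= sigma -> 0 <= gamma -> 0 < lambda -> 0 < alpha -> (0 < n)%N ->
  standard_BM P W ->
  nash_mv P W T S0 sigma gamma lambda (fun _ => alpha) xs vs ->
  let thh := Num.sqrt (gamma ^+ 2 + 4 * alpha * sigma ^+ 2 * lambda) / (2 * lambda) in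
  let rhh := Num.sqrt ((n%:R - 1) ^+ 2 * gamma ^+ 2 + 4 * (n%:R + 1) * alpha * sigma ^+ 2 * lambda)
             / (2 * (n%:R + 1) * lambda) in
  0 < thh -> 0 < rhh ->
  let thp := gamma / (2 * lambda) + thh in
  let thm := gamma / (2 * lambda) - thh in
  let rhp := - ((n%:R - 1) * gamma / (2 * (n%:R + 1) * lambda)) + rhh in
  let rhm := - ((n%:R - 1) * gamma / (2 * (n%:R + 1) * lambda)) - rhh in
  let xbar := (\sum_(j < n) xs j) / n%:R in
  let ci_p := fun i : 'I_n => (xbar - xs i) / (expR (2 * thh * T) - 1) in
  let ci_m := fun i : 'I_n => - (xbar - xs i) / (1 - expR (- (2 * thh * T))) in
  let c_p := - xbar / (expR (2 * rhh * T) - 1) in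
  let c_m := xbar / (1 - expR (- (2 * rhh * T))) in
  let Sig := fun t => \sum_(i < n) pos (xs i) (vs i) t in
  (forall (i : 'I_n) (t : R), 0 <= t <= T ->
     pos (xs i) (vs i) t = ci_p i * expR (thp * t) + ci_m i * expR (thm * t)
                           + c_p * expR (rhp * t) + c_m * expR (rhm * t)) /\
  (forall t : R, 0 <= t <= T ->
     Sig t = n%:R * xbar / (2 * ((expR (rhh * T) - expR (- (rhh * T))) / 2))
             * (expR (rhh * T) * expR (rhm * t) - expR (- (rhh * T)) * expR (rhp * t))) /\
  (forall t : R, 0 < t < T ->
     [/\ derivable Sig t 1, derivable (derive1 Sig) t 1 &
         alpha * sigma ^+ 2 * Sig t - (n%:R - 1) * gamma * derive1 Sig t
         - (n%:R + 1) * lambda * derive1 (derive1 Sig) t = 0]) /\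
  Sig 0 = \sum_(i < n) xs i /\ Sig T = 0.
Proof.
move=> T0 sigma0 gamma0 lambda0 alpha0 n0 bmW nash thh rhh thh0 rhh0
  thp thm rhp rhm xbar ci_p ci_m c_p c_m Sig.
have N0 : 0 < n%:R :> R by rewrite ltr0n.
have NN0 : n%:R != 0 :> R by rewrite gt_eqF.
have N10 : 0 < n%:R + 1 :> R by rewrite addr_gt0.
have sg0 : 0 <= alpha * sigma ^+ 2 * lambda by rewrite !mulr_ge0 ?sqr_ge0// ltW.
have thh2 : (2 * lambda * thh) ^+ 2 = gamma ^+ 2 + 4 * alpha * sigma ^+ 2 * lambda.
  rewrite /thh mulrC divfK ?sqr_sqrtr//; last by rewrite mulf_neq0// gt_eqF.
  by rewrite addr_ge0 ?sqr_ge0//; move: sg0; lra.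
have rhh2 : (2 * (n%:R + 1) * lambda * rhh) ^+ 2 =
    (n%:R - 1) ^+ 2 * gamma ^+ 2 + 4 * (n%:R + 1) * alpha * sigma ^+ 2 * lambda.
  rewrite /rhh mulrC divfK ?sqr_sqrtr//; last by rewrite !mulf_neq0// gt_eqF.
  apply: addr_ge0; first by rewrite mulr_ge0 ?sqr_ge0.
  by have := mulr_ge0 (ltW N10) sg0; lra.
have th12 : thp != thm by rewrite /thp /thm -subr_eq0 gt_eqF//; lra.
have rh12 : rhp != rhm by rewrite /rhp /rhm -subr_eq0 gt_eqF//; lra.
have th_sum : lambda * (thp + thm) = gamma by rewrite /thp /thm; field; rewrite gt_eqF.
have th_mul : lambda * (thp * thm) = - (alpha * sigma ^+ 2).
  (* The product of the roots is a difference of squares, in which [thh2] eliminates the square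
     root. *)
  rewrite (_ : lambda * (thp * thm) = (gamma ^+ 2 - (2 * lambda * thh) ^+ 2) / (4 * lambda)).
    by rewrite thh2; field; rewrite gt_eqF.
  by rewrite /thp /thm; field; rewrite gt_eqF.
have rh_sum : (n%:R + 1) * lambda * (rhp + rhm) = - ((n%:R - 1) * gamma).
  by rewrite /rhp /rhm; field; rewrite !gt_eqF.
have rh_mul : (n%:R + 1) * lambda * (rhp * rhm) = - (alpha * sigma ^+ 2).
  rewrite (_ : (n%:R + 1) * lambda * (rhp * rhm) =
    ((n%:R - 1) ^+ 2 * gamma ^+ 2 - (2 * (n%:R + 1) * lambda * rhh) ^+ 2)
      / (4 * (n%:R + 1) * lambda)).
    by rewrite rhh2; field; rewrite !gt_eqF.
  by rewrite /rhp /rhm; field; rewrite !gt_eqF.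
have Sig0 : Sig 0 = \sum_(i < n) xs i.
  by apply: eq_bigr => j _; exact: nash_position0.
have SigT : Sig T = 0.
  by apply: big1 => j _; exact: nash_positionT nash j.
have zD : 0 <= (0 : R) <= T by rewrite lexx (ltW T0).
have TD : 0 <= T <= T by rewrite lexx (ltW T0).
have [a1 [a2 SE]] := nash_total_exp T0 lambda0 n0 bmW nash rh12 rh_sum rh_mul.
have [a1E a2E] : a1 = n%:R * c_p /\ a2 = n%:R * c_m.
  have rd : rhp - rhm = 2 * rhh by rewrite /rhp /rhm; ring.
  have b0 : a1 + a2 = n%:R * xbar.
    by rewrite /xbar mulrC divfK// -Sig0 /Sig SE// !mulr0 expR0 !mulr1.
  have bT : a1 * expR (rhp * T) + a2 * expR (rhm * T) = 0 by rewrite -SE.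
  have [-> ->] := two_exponentials_boundary T0 rhh0 rd b0 bT.
  by split; rewrite /c_p /c_m mulrA ?mulrN.
split; [|split; [|split; [|by []]]].
- move=> i t tD.
  have [b1 [b2 DE]] := nash_deviation_exp T0 lambda0 n0 bmW nash i th12 th_sum th_mul.
  have td : thp - thm = 2 * thh by rewrite /thp /thm; ring.
  have b0 : b1 + b2 = xs i - xbar.
    have := DE 0 zD; rewrite !mulr0 expR0 !mulr1 nash_position0 => <-.
    by congr (_ - _ / _); rewrite -Sig0.
  have bT : b1 * expR (thp * T) + b2 * expR (thm * T) = 0.
    by rewrite -DE// (nash_positionT nash) -/(Sig T) SigT mul0r subr0.
  have [b1E b2E] := two_exponentials_boundary T0 thh0 td b0 bT.
  have b1E' : b1 = ci_p i by rewrite b1E opprB.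
  have b2E' : b2 = ci_m i by rewrite b2E /ci_m opprB.
  (* The position is its deviation from the mean plus an n-th of the total, which is why the
     coefficients at [rhp] and [rhm] do not depend on [i]. *)
  have := DE t tD; rewrite -/(Sig t) /Sig SE// a1E a2E b1E' b2E' => /(canRL (subrK _)) ->.
  by field.
- move=> t tD; rewrite /Sig SE// a1E a2E /c_p /c_m.
  (* All constants become rational functions of E = exp(rhh T), and E > 1 keeps the denominators
     away from zero. *)
  rewrite expRN (_ : 2 * rhh * T = rhh * T + rhh * T); last by ring.
  rewrite expRD expRN; set E := expR (rhh * T).
  have E1 : 1 < E by rewrite expR_gt1 mulr_gt0.
  have E0 : E != 0 by rewrite gt_eqF// (lt_trans _ E1).
  have EE : E * E - 1 != 0 by rewrite subr_eq0 gt_eqF// mulr_egt1.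
  by field; rewrite E0 EE.
- exact: exp_combination_ode SE rh_sum rh_mul.
Qed.
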